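(* Let $Z,W$ be open neighborhoods of $\mathbf 0\in\mathbb C^m$ and suppose that $H:Z\to W$ is a holomorphic map such that $H(\mathbf 0)=\mathbf 0$, $H(Z\cap\mathbb R^m)\subset\mathbb R^m$ and $H^{-1}(W\cap\mathbb R^m)\subset\mathbb R^m$. Then $H$ is invertible on a neighborhood of $\mathbf 0$.
   Context: $\mathbb R^m\subset\mathbb C^m$ is the standard real subspace. *)

(* Defs.v *)
From HB Require Import structures.
From mathcomp Require Import all_boot all_order all_algebra.
From mathcomp Require Import complex.
From mathcomp Require Import all_classical all_reals all_analysis.
Import Order.TTheory GRing.Theory Num.Theory.
Import numFieldNormedType.Exports.

Set Implicit Arguments.
Unset Strict Implicit.
Unset Printing Implicit Defensive.

Local Open Scope classical_set_scope.
Local Open Scope ring_scope.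

(* The library puts the norm topology on abstract numeric fields only; this
   makes it available on the concrete type R[i]. *)
HB.instance Definition _ (R : realType) :=
  NormedModule.copy R[i] (R[i] : numClosedFieldType)^o.

Definition real_subspace (R : realType) (m : nat) : set 'rV[R[i]]_m :=
  range (map_mx (real_complex R) : 'rV[R]_m -> 'rV[R[i]]_m).

(* The scalars of the normed modules are R[i], so [differentiable] is complex
   (Fréchet) differentiability.  Only used for open U, in which case the values
   of the total function f outside U are irrelevant. *)
Definition holomorphic_on (R : realType) (m n : nat) (U : set 'rV[R[i]]_m)
    (f : 'rV[R[i]]_m -> 'rV[R[i]]_n) : Prop :=
  forall z, U z -> differentiable f z.

Definition biholomorphic_on (R : realType) (m n : nat)
    (U : set 'rV[R[i]]_m) (V : set 'rV[R[i]]_n)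
    (f : 'rV[R[i]]_m -> 'rV[R[i]]_n) : Prop :=
  exists g : 'rV[R[i]]_n -> 'rV[R[i]]_m,
    [/\ holomorphic_on U f, holomorphic_on V g,
        f @` U `<=` V /\ g @` V `<=` U,
        (forall z, U z -> g (f z) = z) &
        (forall w, V w -> f (g w) = w)].

(* Invertibility is meant in the holomorphic category: the local inverse is
   defined on an open neighbourhood of f a and is holomorphic there. *)
Definition invertible_near (R : realType) (m n : nat)
    (Z : set 'rV[R[i]]_m) (W : set 'rV[R[i]]_n)
    (f : 'rV[R[i]]_m -> 'rV[R[i]]_n) (a : 'rV[R[i]]_m) : Prop :=
  exists U V, [/\ open_nbhs a U, U `<=` Z, open_nbhs (f a) V, V `<=` W
                & biholomorphic_on U V f].

(* Main.v *)
(* Write Im for the coordinatewise imaginary part and |.|_2 for the Euclidean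
   norm on R^m.

   The function w |-> |Im w|_2 is harmonic along every complex line a + s b with
   a, b real, and every w off R^m lies on such a line, with b = Im w.  For a real
   vector e the function phi(z) = <Im z, e> - |Re z|_2^2 + 3 |Im z|_2^2 is the real
   part of a holomorphic function plus |z|_2^2.  Hence phi - C |Im H|_2 has no local
   maximum at a point z0 with H(z0) not real: take v <> 0 with DH(z0) v a multiple
   (possibly 0) of Im H(z0); on small discs z0 + s v the second order terms of
   |Im H|_2 are negligible against the gain |s v|_2^2, and the maximum principle for
   real parts of holomorphic functions applies.

   On a small ball, H is real only at real points, where phi <= 0; near the real
   points of the boundary sphere phi < 0.  So phi <= C |Im H|_2 on the ball for
   some C.  If DH(0) v = 0 with e = Im v <> 0, then at t v the left-hand side is
   t |e|_2^2 + O(t^2) and the right-hand side o(t): contradiction.  So DH(0) is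
   invertible, and the inverse function theorem concludes.

   Holomorphy being mere complex differentiability, Goursat's argument provides
   the maximum principle, which in turn gives Cauchy's estimate and the strict
   differentiability needed for the inverse function theorem. *)
(* Importing [all_analysis] first would make a duplicate normed module structure on
   [R] canonical, the one declared in [lebesgue_stieltjes_measure]. *)
From mathcomp Require Import normedtype.
Import numFieldNormedType.Exports.
Require Import Defs.
From mathcomp Require Import all_boot all_order all_algebra.
From mathcomp Require Import ring lra.
From mathcomp Require Import complex.
From mathcomp Require Import all_classical all_reals all_analysis.
Import Order.TTheory GRing.Theory Num.Theory.
Import numFieldNormedType.Exports.
Set Implicit Arguments.
Unset Strict Implicit.
Unset Printing Implicit Defensive.
Local Open Scope classical_set_scope.
Local Open Scope ring_scope.

(** * Goursat's theorem on rectangles *)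

Lemma is_derive_epsilon (R : realType) (f : R -> R) (x d : R) :
  (forall e : R, 0 < e -> exists2 r : R, 0 < r &
     forall h, `|h| < r -> `|f (x + h) - f x - d * h| <= e * `|h|) ->
  is_derive x 1 f d.
Proof.
move=> fd.
have key (u v h : R) : h != 0 -> h^-1 * (u - v) - d = (u - v - d * h) / h.
  by move=> ?; field.
have cv : (fun h => h^-1 *: ((f \o shift x) (h *: 1) - f x)) @ 0^' --> d.
  apply/cvgrPdist_le => e e0.
  have [r r0 fr] := fd _ e0.
  near=> h.
  have h0 : h != 0 by near: h; exact: nbhs_dnbhs_neq.
  have hr : `|h| < r by near: h; apply: dnbhs0_lt.
  have := fr _ hr.
  rewrite -ler_pdivrMr ?normr_gt0// -normfV -normrM distrC; apply: le_trans.
  rewrite le_eqVlt; apply/orP; left; apply/eqP; congr (`|_|).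
  have -> : (f \o shift x) (h *: 1) = f (x + h) by rewrite /= [_%:A]mulr1 addrC.
  rewrite [_ *: _]/(h^-1 * (f (x + h) - f x)).
  exact: (key (f (x + h)) (f x) h).
by split; [apply/cvg_ex; exists d|apply: cvg_lim].
Unshelve. all: by end_near. Qed.

(** The integral from [a] is a primitive at interior points only; this is why [circle_mean] works on
    intervals slightly larger than those it needs. *)
Lemma primitive_exists (R : realType) (f : R -> R) (a b : R) :
  {within `[a, b], continuous f} ->
  exists F : R -> R, forall x, x \in `]a, b[ -> is_derive x 1 F (f x).
Proof.
move=> cf; have [ab|ba] := ltP a b; last first.
  by exists f => x; rewrite in_itv/= => /andP[ax xb]; have := lt_trans ax xb; rewrite ltNge ba.
exists (fun x => \int[lebesgue_measure]_(t in `[a, x]) f t)%R => x xab.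
have := xab; rewrite in_itv/= => /andP[ax xb].
have intf : lebesgue_measure.-integrable `[a, b] (EFin \o f).
  apply: continuous_compact_integrable => //; exact: segment_compact.
have cfx : {for x, continuous f}.
  by move: cf => /(continuous_within_itvP _ ab)[+ _ _]; apply.
have [dF F'] := continuous_FTC1_closed xb intf ax cfx.
by apply: DeriveDef; [exact: dF | rewrite -derive1E F'].
Qed.

Lemma mvt_derive (R : realType) (f f' : R -> R) (a b : R) : a <= b ->
  (forall x, x \in `[a, b] -> is_derive x 1 f (f' x)) ->
  exists2 c, c \in `[a, b] & f b - f a = f' c * (b - a).
Proof.
move=> ab fd.
have fd' x : x \in `]a, b[ -> is_derive x 1 f (f' x).
  by move=> xab; exact: (fd x (subset_itv_oo_cc xab)).
have fc : {within `[a, b], continuous f}.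
  apply: continuous_in_subspaceT => x; rewrite inE/= => xab.
  apply/differentiable_continuous/derivable1_diffP.
  exact: (@ex_derive _ _ _ _ _ _ _ (fd x xab)).
exact: (MVT_segment ab fd' fc).
Qed.

(* For [D = Q - P] with [dP/dx = p] and [dQ/dy = q], this is the circulation of
   [p dx + q dy] along the boundary of the rectangle [a, b] x [c, d]. *)
Definition circulation (R : realType) (D : R -> R -> R) (a b c d : R) : R :=
  D b d - D b c - D a d + D a c.

(** Fréchet differentiability at a single point, with no continuity of the partial derivatives; the
    l1 norm fits the half-perimeter [l + l'] of rectangles. *)
Definition has_differential2 (R : realType) (p : R -> R -> R) (x y px py : R) :=
  forall e : R, 0 < e -> exists2 r : R, 0 < r &
    forall h k : R, `|h| + `|k| < r ->
      `|p (x + h) (y + k) - p x y - px * h - py * k| <= e * (`|h| + `|k|).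

Section Goursat.
Variables (R : realType) (p q P Q : R -> R -> R) (a b c d : R).
Hypothesis (ab : a <= b) (cd : c <= d).
Hypothesis dP : forall x y, x \in `[a, b] -> y \in `[c, d] ->
  is_derive x 1 (P ^~ y) (p x y).
Hypothesis dQ : forall x y, x \in `[a, b] -> y \in `[c, d] ->
  is_derive y 1 (Q x) (q x y).
Hypothesis closed_form : forall x y, x \in `[a, b] -> y \in `[c, d] ->
  exists px py qy, has_differential2 p x y px py /\ has_differential2 q x y py qy.

Let J := circulation (fun x y => Q x y - P x y).

(** By the mean value theorem the circulation equals an increment of [q] times [l'] minus an
    increment of [p] times [l]. The affine parts of [p] and [q] at (x, y) contribute [py * l * l']
    to both and cancel, by [closed_form]; only the remainders are left. *)
Lemma circulation_small (x y e : R) : x \in `[a, b] -> y \in `[c, d] -> 0 < e ->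
  exists2 r : R, 0 < r & forall a' c' l l' : R,
    a <= a' -> a' <= x -> x <= a' + l -> a' + l <= b ->
    c <= c' -> c' <= y -> y <= c' + l' -> c' + l' <= d ->
    l + l' < r -> `|J a' (a' + l) c' (c' + l')| <= e * (l + l') ^+ 2.
Proof.
move=> xab ycd e0; have [px [py [qy [dp dq]]]] := closed_form xab ycd.
have e20 : 0 < e / 4 by lra.
have [r1 r10 pr1] := dp _ e20.
have [r2 r20 qr2] := dq _ e20.
exists (Num.min r1 r2); first by rewrite lt_min r10.
move=> a' c' l l' aa' a'x xa'l a'lb cc' c'y yc'l c'ld.
rewrite lt_min => /andP[llr1 llr2].
have in1 s : s \in `[a', a' + l] -> s \in `[a, b] by rewrite !in_itv/=; lra.
have in2 s : s \in `[c', c' + l'] -> s \in `[c, d] by rewrite !in_itv/=; lra.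
have near s t : s \in `[a', a' + l] -> t \in `[c', c' + l'] ->
    `|s - x| + `|t - y| <= l + l'.
  rewrite !in_itv/= => /andP[? ?] /andP[? ?].
  by apply: lerD; rewrite ler_norml; apply/andP; split; lra.
have pE s t : s \in `[a', a' + l] -> t \in `[c', c' + l'] ->
    `|p s t - p x y - px * (s - x) - py * (t - y)| <= e / 4 * (l + l').
  move=> sI tI; have := near _ _ sI tI => st.
  have := pr1 (s - x) (t - y) (le_lt_trans st llr1).
  by rewrite !subrKC => /le_trans; apply; rewrite ler_pM2l.
have qE s t : s \in `[a', a' + l] -> t \in `[c', c' + l'] ->
    `|q s t - q x y - py * (s - x) - qy * (t - y)| <= e / 4 * (l + l').
  move=> sI tI; have := near _ _ sI tI => st.
  have := qr2 (s - x) (t - y) (le_lt_trans st llr2).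
  by rewrite !subrKC => /le_trans; apply; rewrite ler_pM2l.
have I1 : a' \in `[a', a' + l] by rewrite in_itv/=; lra.
have I2 : a' + l \in `[a', a' + l] by rewrite in_itv/=; lra.
have I3 : c' \in `[c', c' + l'] by rewrite in_itv/=; lra.
have I4 : c' + l' \in `[c', c' + l'] by rewrite in_itv/=; lra.
(* Applied to the difference of the top and bottom sides, so that a single [s] serves both. *)
have [s sI Ps] : exists2 s, s \in `[a', a' + l] &
    (P (a' + l) (c' + l') - P (a' + l) c') - (P a' (c' + l') - P a' c') =
    (p s (c' + l') - p s c') * l.
  have dd s : s \in `[a', a' + l] ->
      is_derive s 1 (P ^~ (c' + l') - P ^~ c') (p s (c' + l') - p s c').
    by move=> sI; exact: (is_deriveB (dP (in1 s sI) (in2 _ I4))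
                                     (dP (in1 s sI) (in2 _ I3))).
  have le : a' <= a' + l by lra.
  have [s sI E] := mvt_derive le dd.
  by exists s => //; rewrite [a' + l - a']addrAC subrr add0r in E.
have [t tI Qt] : exists2 t, t \in `[c', c' + l'] &
    (Q (a' + l) (c' + l') - Q a' (c' + l')) - (Q (a' + l) c' - Q a' c') =
    (q (a' + l) t - q a' t) * l'.
  have dd t : t \in `[c', c' + l'] ->
      is_derive t 1 (Q (a' + l) - Q a') (q (a' + l) t - q a' t).
    by move=> tI; exact: (is_deriveB (dQ (in1 _ I2) (in2 t tI))
                                     (dQ (in1 _ I1) (in2 t tI))).
  have le : c' <= c' + l' by lra.
  have [t tI E] := mvt_derive le dd.
  by exists t => //; rewrite [c' + l' - c']addrAC subrr add0r in E.
have JE : J a' (a' + l) c' (c' + l') =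
    (q (a' + l) t - q a' t) * l' - (p s (c' + l') - p s c') * l.
  by rewrite -Ps -Qt /J /circulation; ring.
have l0 : 0 <= l by lra.
have l'0 : 0 <= l' by lra.
have := pE _ _ sI I4; have := pE _ _ sI I3.
have := qE _ _ I1 tI; have := qE _ _ I2 tI.
set u1 := q (a' + l) t - _ - _ - _; set u2 := q a' t - _ - _ - _.
set u3 := p s c' - _ - _ - _; set u4 := p s (c' + l') - _ - _ - _.
move=> U1 U2 U3 U4.
have -> : J a' (a' + l) c' (c' + l') = (u1 - u2) * l' - (u4 - u3) * l.
  by rewrite JE /u1 /u2 /u3 /u4; ring.
rewrite (le_trans (ler_normB _ _))// !normrM (ger0_norm l0) (ger0_norm l'0).
have U12 : `|u1 - u2| <= e / 2 * (l + l').
  by apply: le_trans (ler_normB _ _) _; lra.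
have U34 : `|u4 - u3| <= e / 2 * (l + l').
  by apply: le_trans (ler_normB _ _) _; lra.
apply: (@le_trans _ _ (e / 2 * (l + l') * l' + e / 2 * (l + l') * l)).
  by apply: lerD; rewrite ler_wpM2r.
by rewrite -mulrDr [l' + l]addrC -mulrA -expr2 ler_wpM2r ?sqr_ge0//; lra.
Qed.

(** Circulation is additive over the four quarters, so one of them carries at least a quarter of its
    absolute value. [u] selects the right half and [v] the upper half. *)
Lemma circulation_quarter (a' c' l l' : R) :
  exists u v : bool, `|J a' (a' + l) c' (c' + l')| / 4 <=
    `|J (a' + u%:R * (l / 2)) (a' + u%:R * (l / 2) + l / 2)
        (c' + v%:R * (l' / 2)) (c' + v%:R * (l' / 2) + l' / 2)|.
Proof.
apply: contrapT => /forallNP N.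
have N' (u v : bool) : `|J (a' + u%:R * (l / 2)) (a' + u%:R * (l / 2) + l / 2)
        (c' + v%:R * (l' / 2)) (c' + v%:R * (l' / 2) + l' / 2)|
     < `|J a' (a' + l) c' (c' + l')| / 4.
  by rewrite ltNge; apply/negP => H; apply: (N u); exists v.
have := N' false false; have := N' false true.
have := N' true false; have := N' true true.
rewrite /= !mul0r !mul1r !addr0 -!addrA -!splitr.
set j := J a' (a' + l) c' (c' + l').
have -> : j = J (a' + l / 2) (a' + l) (c' + l' / 2) (c' + l')
  + J (a' + l / 2) (a' + l) c' (c' + l' / 2)
  + J a' (a' + l / 2) (c' + l' / 2) (c' + l')
  + J a' (a' + l / 2) c' (c' + l' / 2) by rewrite /j /J /circulation; ring.
set j1 := J _ _ _ _; set j2 := J _ _ _ _; set j3 := J _ _ _ _; set j4 := J _ _ _ _.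
have := ler_normD (j1 + j2 + j3) j4; have := ler_normD (j1 + j2) j3.
by have := ler_normD j1 j2; lra.
Qed.

(** The left endpoints increase and stay below every right endpoint, so their supremum is a common
    point. *)
Lemma nested_halving (x : nat -> R) (l : R) :
  (forall n, x n <= x n.+1) ->
  (forall n, x n.+1 + l / 2 ^+ n.+1 <= x n + l / 2 ^+ n) -> 0 <= l ->
  exists X, forall n, x n <= X /\ X <= x n + l / 2 ^+ n.
Proof.
move=> xS yS l0.
have xle m n : (m <= n)%N -> x m <= x n.
  by move=> mn; apply: (@homo_leq _ x (fun u v => u <= v)) => //; exact: le_trans.
have yle m n : (m <= n)%N -> x n + l / 2 ^+ n <= x m + l / 2 ^+ m.
  move=> mn; apply: (@homo_leq _ (fun k => x k + l / 2 ^+ k) (fun u v => v <= u)) => //.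
  by move=> u v w uv vw; exact: le_trans vw uv.
have xy m n : x m <= x n + l / 2 ^+ n.
  have ln k : x k <= x k + l / 2 ^+ k by rewrite lerDl divr_ge0// exprn_ge0.
  have [mn|/ltnW nm] := leqP m n; first exact: le_trans (xle _ _ mn) (ln n).
  exact: le_trans (ln m) (yle _ _ nm).
have hs : has_sup (range x).
  by split; [exists (x 0), 0 | exists (x 0 + l / 2 ^+ 0) => _ [n _ <-]].
exists (sup (range x)) => n; split.
  by apply: sup_upper_bound => //; exists n.
by apply: sup_le_ub; [case: hs|move=> _ [m _ <-]].
Qed.

(** Goursat's bisection: keeping the worst quarter n times leaves a circulation of at least
    [|J a b c d| / 4 ^+ n], while [circulation_small] at the limit point bounds it by
    [e' * (l + l') ^+ 2 / 4 ^+ n] with [e'] arbitrary. *)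
Lemma circulation_eq0 : J a b c d = 0.
Proof.
set l := b - a; set l' := d - c.
have l0 : 0 <= l by rewrite subr_ge0.
have l'0 : 0 <= l' by rewrite subr_ge0.
have [f fP] := choice (fun t : R * R * R * R =>
  circulation_quarter t.1.1.1 t.1.1.2 t.1.2 t.2).
have [g gP] := choice fP.
(* [s n] is the lower left corner of the n-th rectangle, whose sides are [l / 2 ^+ n] and
   [l' / 2 ^+ n]. *)
pose step k (xy : R * R) := let t := (xy, l / 2 ^+ k, l' / 2 ^+ k) in
  (xy.1 + (f t)%:R * (l / 2 ^+ k.+1), xy.2 + (g t)%:R * (l' / 2 ^+ k.+1)).
pose s n := iteri n step (a, c).
pose j n := J (s n).1 ((s n).1 + l / 2 ^+ n) (s n).2 ((s n).2 + l' / 2 ^+ n).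
have half (m : R) n : m / 2 ^+ n.+1 = m / 2 ^+ n / 2.
  by rewrite exprSr invfM mulrA.
have jS n : `|j n| / 4 <= `|j n.+1|.
  have := gP (s n, l / 2 ^+ n, l' / 2 ^+ n).
  by rewrite /j /s [iteri n.+1 _ _]/= -/(s n) /step /= !half.
have sz (x : R) (u : bool) (m : R) n : 0 <= m ->
    x <= x + u%:R * (m / 2 ^+ n.+1) /\
    x + u%:R * (m / 2 ^+ n.+1) + m / 2 ^+ n.+1 <= x + m / 2 ^+ n.
  move=> m0; have : 0 <= m / 2 ^+ n by rewrite divr_ge0// exprn_ge0.
  by rewrite half; case: u => /=; set w := m / _ => w0; lra.
have [X XP] : exists X, forall n, (s n).1 <= X /\ X <= (s n).1 + l / 2 ^+ n.
  by apply: nested_halving => // n; case: (sz (s n).1 (f (s n, l / 2 ^+ n, l' / 2 ^+ n)) l n l0).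
have [Y YP] : exists Y, forall n, (s n).2 <= Y /\ Y <= (s n).2 + l' / 2 ^+ n.
  by apply: nested_halving => // n; case: (sz (s n).2 (g (s n, l / 2 ^+ n, l' / 2 ^+ n)) l' n l'0).
have inS n : (a <= (s n).1 /\ (s n).1 + l / 2 ^+ n <= b) /\
             (c <= (s n).2 /\ (s n).2 + l' / 2 ^+ n <= d).
  elim: n => [|n [[A1 A2] [A3 A4]]]; first by rewrite /= !divr1 /l /l' !subrKC.
  have [B1 B2] := sz (s n).1 (f (s n, l / 2 ^+ n, l' / 2 ^+ n)) l n l0.
  have [B3 B4] := sz (s n).2 (g (s n, l / 2 ^+ n, l' / 2 ^+ n)) l' n l'0.
  split; split; [exact: le_trans A1 B1|exact: le_trans B2 A2|
                 exact: le_trans A3 B3|exact: le_trans B4 A4].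
have Xab : X \in `[a, b].
  rewrite in_itv/=; have [[A1 A2] _] := inS 0%N; have [B1 B2] := XP 0%N.
  by rewrite (le_trans A1 B1) (le_trans B2 A2).
have Ycd : Y \in `[c, d].
  rewrite in_itv/=; have [_ [A1 A2]] := inS 0%N; have [B1 B2] := YP 0%N.
  by rewrite (le_trans A1 B1) (le_trans B2 A2).
have j0 : J a b c d = j 0%N by rewrite /j /= !divr1 /l /l' !subrKC.
have jn n : `|j 0%N| / 4 ^+ n <= `|j n|.
  elim: n => [|n IH]; first by rewrite divr1.
  by apply: le_trans (jS n); rewrite exprSr invfM mulrA ler_pM2r.
rewrite j0; apply/eqP; rewrite -normr_eq0 eq_le normr_ge0 andbT.
apply/ler_addgt0Pr => e e0; rewrite add0r.
have [e' e'0 e'e] : exists2 e' : R, 0 < e' & e' * (l + l') ^+ 2 <= e.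
  have lp : 0 < (l + l') ^+ 2 + 1 by rewrite ltr_wpDl// sqr_ge0.
  exists (e / ((l + l') ^+ 2 + 1)); first exact: divr_gt0.
  by rewrite mulrAC ler_pdivrMr// ler_pM2l// lerDl.
have [r r0 rP] := circulation_small Xab Ycd e'0.
have [n nP] : exists n, (l + l') / 2 ^+ n < r.
  exists (Num.bound ((l + l') / r)).
  rewrite ltr_pdivrMr ?exprn_gt0// -ltr_pdivrMl// mulrC.
  apply: lt_le_trans (archi_boundP _) _; first by apply: divr_ge0; [exact: addr_ge0|exact: ltW].
  by rewrite -natrX ler_nat ltnW// ltn_expl.
have [[A1 A2] [A3 A4]] := inS n; have [B1 B2] := XP n; have [B3 B4] := YP n.
have := rP _ _ (l / 2 ^+ n) (l' / 2 ^+ n) A1 B1 B2 A2 A3 B3 B4 A4.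
rewrite -mulrDl => /(_ nP); rewrite -/(j n) => H.
have := le_trans (jn n) H.
have E : ((l + l') / 2 ^+ n) ^+ 2 = (l + l') ^+ 2 / 4 ^+ n.
  have -> : 4 = 2 ^+ 2 :> R by rewrite -natrX.
  by rewrite exprMn exprVn -!exprM mulnC.
rewrite E mulrA ler_pM2r ?invr_gt0 ?exprn_gt0//.
by move=> /le_trans; apply.
Qed.

End Goursat.

(** * Real-valued norms over R[i] *)

Section RealNorm.
Variables (R : realType) (V : normedModType R[i]).
Implicit Types (v w : V) (a : R[i]).

(** Norms of modules over [R[i]] lie in [R[i]], which is only partially ordered; since they are
    real, the real part loses nothing and gives estimates in the ordered field [R]. *)
Definition rnorm v : R := complex.Re `|v|.

Lemma rnormE v : `|v| = (rnorm v)%:C%C.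
Proof. by rewrite /rnorm RRe_real// normr_real. Qed.

Lemma rnorm_ge0 v : 0 <= rnorm v.
Proof. by rewrite -ler0c -rnormE. Qed.

Lemma rnorm0 : rnorm (0 : V) = 0.
Proof. by rewrite /rnorm normr0. Qed.

Lemma rnorm_eq0 v : (rnorm v == 0) = (v == 0).
Proof. by rewrite -[RHS]normr_eq0 rnormE -(inj_eq (@complexI R)). Qed.

Lemma rnorm_gt0 v : (0 < rnorm v) = (v != 0).
Proof. by rewrite lt_neqAle rnorm_ge0 andbT eq_sym rnorm_eq0. Qed.

Lemma rnormN v : rnorm (- v) = rnorm v.
Proof. by rewrite /rnorm normrN. Qed.

Lemma rdistC v w : rnorm (v - w) = rnorm (w - v).
Proof. by rewrite -rnormN opprB. Qed.

Lemma rnorm_triangle v w : rnorm (v + w) <= rnorm v + rnorm w.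
Proof. by rewrite -lecR rmorphD/= -!rnormE ler_normD. Qed.

Lemma rnorm_triangleB v w : rnorm (v - w) <= rnorm v + rnorm w.
Proof. by rewrite -(rnormN w) rnorm_triangle. Qed.

End RealNorm.

Section RealNormTheory.
Variables (R : realType).

Lemma rnormZ (V : normedModType R[i]) (a : R[i]) (v : V) :
  rnorm (a *: v) = rnorm a * rnorm v.
Proof. by apply: (@complexI R); rewrite rmorphM/= -!rnormE normrZ. Qed.

Lemma rnormM (a b : R[i]) : rnorm (a * b) = rnorm a * rnorm b.
Proof. exact: rnormZ. Qed.

Lemma rnormV (a : R[i]) : rnorm a^-1 = (rnorm a)^-1.
Proof. by apply: (@complexI R); rewrite fmorphV/= -!rnormE normfV. Qed.

Lemma rnorm_real (x : R) : rnorm (x%:C%C : R[i]) = `|x|.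
Proof.
by rewrite /rnorm normc_def /= expr0n addr0 sqrtr_sqr.
Qed.

Lemma rnorm_sqrtE (a : R[i]) :
  rnorm a = Num.sqrt (complex.Re a ^+ 2 + complex.Im a ^+ 2).
Proof. by rewrite /rnorm normc_def. Qed.

Lemma rnorm_sqr (a : R[i]) :
  rnorm a ^+ 2 = complex.Re a ^+ 2 + complex.Im a ^+ 2.
Proof. by rewrite rnorm_sqrtE sqr_sqrtr// addr_ge0// sqr_ge0. Qed.

Lemma Re_le_rnorm (a : R[i]) : `|complex.Re a| <= rnorm a.
Proof. by rewrite rnorm_sqrtE -sqrtr_sqr ler_wsqrtr// lerDl sqr_ge0. Qed.

Lemma Im_le_rnorm (a : R[i]) : `|complex.Im a| <= rnorm a.
Proof. by rewrite rnorm_sqrtE -sqrtr_sqr ler_wsqrtr// lerDr sqr_ge0. Qed.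

Lemma rnorm_le_ReIm (a : R[i]) : rnorm a <= `|complex.Re a| + `|complex.Im a|.
Proof.
rewrite -(@ler_pXn2r _ 2) ?nnegrE ?rnorm_ge0 ?addr_ge0//.
rewrite rnorm_sqr sqrrD !real_normK ?num_real// addrAC lerDl.
by rewrite mulrn_wge0// mulr_ge0.
Qed.

Lemma nbhs_rnormP (V : normedModType R[i]) (x : V) (A : set V) :
  nbhs x A <-> exists2 r : R, 0 < r & forall y, rnorm (y - x) < r -> A y.
Proof.
split=> [/nbhs_normP[e /= e0 eA]|[r r0 rA]].
  have eE : e = (complex.Re e)%:C%C by rewrite RRe_real// gtr0_real.
  exists (complex.Re e); first by rewrite -ltcR -eE.
  by move=> y yx; apply: eA; rewrite /= eE -normrN opprB rnormE ltcR.
apply/nbhs_normP; exists r%:C%C; first by rewrite /= ltcR.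
by move=> y /=; rewrite -normrN opprB rnormE ltcR; exact: rA.
Qed.

Lemma continuous_rnormP (V W : normedModType R[i]) (f : V -> W) (x : V) :
  {for x, continuous f} <-> forall e : R, 0 < e -> exists2 r : R, 0 < r &
    forall y, rnorm (y - x) < r -> rnorm (f y - f x) < e.
Proof.
split=> [cf e e0|H A].
  have /cf/nbhs_rnormP[r r0 rP] : nbhs (f x) [set w | rnorm (w - f x) < e].
    by apply/nbhs_rnormP; exists e.
  by exists r.
move=> /nbhs_rnormP[e e0 eA]; have [r r0 rP] := H _ e0.
by apply/nbhs_rnormP; exists r => // y /rP; exact: eA.
Qed.

Lemma differentiable_rnormP (V W : normedModType R[i]) (f : V -> W) (x : V) :
  differentiable f x -> forall e : R, 0 < e -> exists2 r : R, 0 < r &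
    forall h, rnorm h < r ->
      rnorm (f (x + h) - f x - 'd f x h) <= e * rnorm h.
Proof.
move=> /diff_locally/eqaddoP fx e e0; have := fx e%:C%C.
rewrite ltcR => /(_ e0)/nbhs_rnormP[r r0 rP].
exists r => // h hr; have := rP h; rewrite subr0 => /(_ hr).
have -> : (f \o shift x - (cst (f x) + 'd f x)) h = f (h + x) - (f x + 'd f x h) by [].
by rewrite [h + x]addrC opprD addrA !rnormE -rmorphM/= lecR.
Qed.

Lemma rnormP_diff (V W : normedModType R[i]) (f : V -> W) (x : V)
    (L : {linear V -> W}) : continuous L ->
  (forall e : R, 0 < e -> exists2 r : R, 0 < r &
    forall h, rnorm h < r -> rnorm (f (x + h) - f x - L h) <= e * rnorm h) ->
  differentiable f x /\ 'd f x = L :> (V -> W).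
Proof.
move=> cL fL.
have E : f \o shift x = cst (f x) + L +o_ 0 id.
  apply/eqaddoP => e e0.
  have eE : e = (complex.Re e)%:C%C by rewrite RRe_real// gtr0_real.
  have [|r r0 rP] := fL (complex.Re e); first by rewrite -ltcR -eE.
  apply/nbhs_rnormP; exists r => // h; rewrite subr0 => /rP.
  have -> : (f \o shift x - (cst (f x) + L)) h = f (h + x) - (f x + L h) by [].
  by rewrite -lecR rmorphM/= -eE -!rnormE [h + x]addrC opprD addrA.
have dE := diff_unique cL E.
by split => //; apply/diff_locallyP; rewrite dE.
Qed.

End RealNormTheory.

(** * The maximum principle *)

Lemma derive_epsilon (R : realType) (f : R -> R) (x d : R) :
  is_derive x 1 f d ->
  forall e : R, 0 < e -> exists2 r : R, 0 < r &
     forall h : R, `|h| < r -> `|f (x + h) - f x - d * h| <= e * `|h|.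
Proof.
move=> [fx fd] e e0.
have key (u v h : R) : h != 0 -> (u - v - d * h) / h = h^-1 * (u - v) - d.
  by move=> ?; field.
have : (fun h : R => h^-1 * (f (x + h) - f x)) @ 0^' --> d.
  rewrite -fd (_ : (fun h : R => _) = (fun h => h^-1 *: ((f \o shift x) (h *: 1) - f x))).
    exact: fx.
  by apply/funext => h; rewrite /= [_%:A]mulr1 [h + x]addrC.
move=> /cvgrPdist_le/(_ e e0)/nbhs_normP[r /= r0 rP].
exists r => // h hr; have [->|h0] := eqVneq h 0.
  by rewrite addr0 subrr mulr0 subrr normr0 mulr0.
have := rP h; rewrite /= sub0r normrN => /(_ hr h0).
rewrite -ler_pdivrMr ?normr_gt0// -normfV -normrM distrC; apply: le_trans.
by rewrite (key (f (x + h)) (f x) h h0).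
Qed.

(** * The complex exponential in real coordinates *)

Section Polar.
Variable R : realType.
Implicit Types (x t h k : R).
Local Open Scope complex_scope.

(** This is exp(x + it): it carries rectangles to annular sectors about 0, and composing with it
    preserves the Cauchy-Riemann equations. *)
Definition polar x t : R[i] := (expR x * cos t) +i* (expR x * sin t).

Lemma polarD x t h k : polar (x + h) (t + k) = polar x t * polar h k.
Proof.
apply/eqP; rewrite eq_complex /= expRD cosD sinD; apply/andP; split; apply/eqP; ring.
Qed.

Lemma rnorm_polar x t : rnorm (polar x t) = expR x.
Proof.
rewrite rnorm_sqrtE /= !exprMn -mulrDr cos2Dsin2 mulr1 sqrtr_sqr ger0_norm // expR_ge0.
Qed.

Lemma polar_neq0 x t : polar x t != 0.
Proof. by rewrite -rnorm_gt0 rnorm_polar expR_gt0. Qed.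

Lemma polar_differential (e : R) : 0 < e -> exists2 r : R, 0 < r &
  forall h k, `|h| + `|k| < r ->
    rnorm (polar h k - 1 - (h +i* k)) <= e * (`|h| + `|k|).
Proof.
move=> e0.
have e4 : 0 < e / 8 by lra.
have [r1 r10 H1] := derive_epsilon (is_derive_expR (0 : R)) e4.
have [r2 r20 H2] := derive_epsilon (is_derive_sin (0 : R)) e4.
have [r3 r30 H3] := derive_epsilon (is_derive_cos (0 : R)) e4.
have [r4 r40 H4] : exists2 r : R, 0 < r & forall h, `|h| < r -> `|expR h - 1| <= e / 8.
  have : expR @ (0 : R) --> (1 : R) by rewrite -expR0; exact: continuous_expR.
  move=> /cvgrPdist_le/(_ _ e4)/nbhs_normP[r /= r0 rP].
  by exists r => // h hr; rewrite distrC; apply: rP; rewrite /= sub0r normrN.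
(* The previous bound absorbs the product [(expR h - 1) * k]; this one only keeps [expR h] below
   2. *)
have [r5 r50 H5] : exists2 r : R, 0 < r & forall h, `|h| < r -> `|expR h - 1| <= 1.
  have : expR @ (0 : R) --> (1 : R) by rewrite -expR0; exact: continuous_expR.
  move=> /cvgrPdist_le/(_ _ ltr01)/nbhs_normP[r /= r0 rP].
  by exists r => // h hr; rewrite distrC; apply: rP; rewrite /= sub0r normrN.
exists (Num.min r1 (Num.min r2 (Num.min r3 (Num.min r4 r5)))).
  by rewrite !lt_min r10 r20 r30 r40 r50.
move=> h k; rewrite !lt_min => /and5P[hk1 hk2 hk3 hk4 hk5].
have hl : `|h| <= `|h| + `|k| by rewrite lerDl.
have kl : `|k| <= `|h| + `|k| by rewrite lerDr.
have {hk1}E1 := H1 h (le_lt_trans hl hk1).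
have {hk2}E2 := H2 k (le_lt_trans kl hk2).
have {hk3}E3 := H3 k (le_lt_trans kl hk3).
have {hk4}E4 := H4 h (le_lt_trans hl hk4).
have {hk5}E5 := H5 h (le_lt_trans hl hk5).
move: E1 E2 E3; rewrite !add0r expR0 cos0 sin0 oppr0 mul0r !subr0 addr0 !mul1r => E1 E2 E3.
have expR2 : `|expR h| <= 2.
  by have := ler_normD (expR h - 1) 1; rewrite subrK normr1; lra.
apply: le_trans (rnorm_le_ReIm _) _ => /=; rewrite !subr0.
have -> : expR h * cos k - 1 - h = (expR h - 1 - h) + expR h * (cos k - 1) by ring.
have -> : expR h * sin k - k = (expR h - 1) * k + expR h * (sin k - k) by ring.
have T1 : `|expR h * (cos k - 1)| <= 2 * (e / 8 * `|k|).
  by rewrite normrM; apply: ler_pM.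
have T2 : `|expR h * (sin k - k)| <= 2 * (e / 8 * `|k|).
  by rewrite normrM; apply: ler_pM.
have T3 : `|(expR h - 1) * k| <= e / 8 * `|k| by rewrite normrM ler_wpM2r.
have h0 := normr_ge0 h; have k0 := normr_ge0 k.
have := ler_normD (expR h - 1 - h) (expR h * (cos k - 1)).
have := ler_normD ((expR h - 1) * k) (expR h * (sin k - k)).
have ek : 0 <= e * `|k| by rewrite mulr_ge0// ltW.
have eh : 0 <= e * `|h| by rewrite mulr_ge0// ltW.
by move: E1 T1 T2 T3 ek eh; clear; lra.
Qed.

End Polar.

Lemma has_differential2_derive1 (R : realType) (p : R -> R -> R) (x y px py : R) :
  has_differential2 p x y px py -> is_derive x 1 (p ^~ y) px.
Proof.
move=> dp; apply: is_derive_epsilon => e /dp[r r0 rP]; exists r => // h hr.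
have := rP h 0; rewrite normr0 addr0 => /(_ hr).
by rewrite addr0 mulr0 subr0.
Qed.

Lemma has_differential2_derive2 (R : realType) (p : R -> R -> R) (x y px py : R) :
  has_differential2 p x y px py -> is_derive y 1 (p x) py.
Proof.
move=> dp; apply: is_derive_epsilon => e /dp[r r0 rP]; exists r => // h hr.
have := rP 0 h; rewrite normr0 add0r => /(_ hr).
by rewrite addr0 mulr0 subr0.
Qed.

Lemma is_derive_continuous (R : realType) (f : R -> R) (x d : R) :
  is_derive x 1 f d -> {for x, continuous f}.
Proof.
move=> fx; apply/differentiable_continuous/derivable1_diffP.
exact: (@ex_derive _ _ _ _ _ _ _ fx).
Qed.

Section MaximumPrinciple.
Variable R : realType.
Implicit Types F : R[i] -> R[i].
Local Open Scope complex_scope.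

(** Chain rule for F(exp): as exp is its own derivative, the factor is F'(z) z with
    [z = polar x t]. *)
Lemma comp_polar_differential F (x t : R) : differentiable F (polar x t) ->
  exists w : R[i], forall e : R, 0 < e -> exists2 r : R, 0 < r &
    forall h k : R, `|h| + `|k| < r ->
      rnorm (F (polar (x + h) (t + k)) - F (polar x t) - w * (h +i* k))
        <= e * (`|h| + `|k|).
Proof.
set z := polar x t => dF; set w := 'd F z 1.
have dFE v : 'd F z v = w * v.
  rewrite mulrC /w -[RHS]/(v *: 'd F z 1) -linearZ.
  by congr ('d F z _); rewrite [RHS]mulr1.
have z0 : 0 < rnorm z by rewrite rnorm_gt0 polar_neq0.
exists (w * z) => e e0.
have w10 : 0 < rnorm w * rnorm z + 1 by rewrite ltr_wpDl// mulr_ge0// rnorm_ge0.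
have e1 : 0 < e / (4 * rnorm z) by rewrite divr_gt0// mulr_gt0.
have e2 : 0 < e / (2 * (rnorm w * rnorm z + 1)) by rewrite divr_gt0// mulr_gt0.
have [r1 r10 H1] := differentiable_rnormP dF e1.
have [r2 r20 H2] := polar_differential e2.
have [r3 r30 H3] := polar_differential (@ltr01 R).
(* The first bound keeps the increment [v = z * (b - 1)], of norm at most
   [2 * rnorm z * (|h| + |k|)], within [r1]. *)
exists (Num.min (r1 / (2 * rnorm z)) (Num.min r2 r3)).
  by rewrite !lt_min r20 r30 divr_gt0// mulr_gt0.
move=> h k; rewrite !lt_min => /and3P[hk1 /H2 E2 /H3 E3].
have hk0 : 0 <= `|h| + `|k| by rewrite addr_ge0.
rewrite polarD; set b := polar h k in E2 E3 *.
set g := h +i* k in E2 E3 *.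
have g2 : rnorm g <= `|h| + `|k| by exact: rnorm_le_ReIm.
pose v := z * (b - 1).
have bv : z * b = z + v by rewrite /v mulrBr mulr1 addrC subrK.
have b1 : rnorm (b - 1) <= 2 * (`|h| + `|k|).
  have := rnorm_triangle (b - 1 - g) g; rewrite subrK; lra.
have v2 : rnorm v <= 2 * rnorm z * (`|h| + `|k|).
  by rewrite rnormM [2 * _]mulrC -mulrA ler_wpM2l// rnorm_ge0.
have vr : rnorm v < r1.
  apply: le_lt_trans v2 _.
  by rewrite mulrC -ltr_pdivlMr// mulr_gt0.
have := H1 v vr; rewrite -bv dFE => E1.
have -> : F (z * b) - F z - w * z * g =
   (F (z * b) - F z - w * v) + w * z * (b - 1 - g) by rewrite /v; ring.
apply: le_trans (rnorm_triangle _ _) _.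
have -> : e * (`|h| + `|k|) = e / 2 * (`|h| + `|k|) + e / 2 * (`|h| + `|k|).
  by rewrite -mulrDl -splitr.
apply: lerD.
  apply: le_trans E1 _; apply: le_trans (ler_wpM2l (ltW e1) v2) _.
  rewrite le_eqVlt; apply/orP; left; apply/eqP; move: z0; clear.
  by move: (rnorm z) => n n0; field; rewrite gt_eqF.
rewrite !rnormM; apply: le_trans (ler_wpM2l _ E2) _.
  by rewrite mulr_ge0// rnorm_ge0.
rewrite mulrA ler_wpM2r// mulrC mulrAC ler_pdivrMr ?mulr_gt0//.
have -> : e / 2 * (2 * (rnorm w * rnorm z + 1)) = e * (rnorm w * rnorm z) + e.
  by field.
by rewrite lerDl ltW.
Qed.

(** Multiplication by a + ib sends (h, k) to (a h - b k, b h + a k). *)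
Lemma polar_Cauchy_Riemann F (x t : R) : differentiable F (polar x t) ->
  exists a b : R,
    has_differential2 (fun x t => complex.Re (F (polar x t))) x t a (- b) /\
    has_differential2 (fun x t => complex.Im (F (polar x t))) x t b a.
Proof.
move=> /comp_polar_differential[[a b] H]; exists a, b.
have ReB (u v : R[i]) : complex.Re (u - v) = complex.Re u - complex.Re v by case: u; case: v.
have ImB (u v : R[i]) : complex.Im (u - v) = complex.Im u - complex.Im v by case: u; case: v.
split=> e /H[r r0 rP]; exists r => // h k /rP; apply: le_trans.
  apply: le_trans (Re_le_rnorm _); rewrite !ReB /=.
  by rewrite le_eqVlt; apply/orP; left; apply/eqP; congr (`|_|); ring.
apply: le_trans (Im_le_rnorm _); rewrite !ImB /=.
by rewrite le_eqVlt; apply/orP; left; apply/eqP; congr (`|_|); ring.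
Qed.

(* By Goursat's argument [Re F] has the same mean over both circles; the mean value
   theorem turns these means into values, so no integral appears. *)
Lemma circle_mean F (X0 : R) : X0 < 0 ->
  (forall z, z != 0 -> rnorm z < 2 -> differentiable F z) ->
  exists t s, complex.Re (F (polar X0 t)) = complex.Re (F (polar 0 s)).
Proof.
move=> X00 dF.
pose u x t := complex.Re (F (polar x t)).
pose v x t := complex.Im (F (polar x t)).
(* The half-plane [x <= B] maps into the disc of radius 2 and extends beyond [x = 0], the unit
   circle, where derivatives of the primitives are needed. *)
pose B : R := ln (3 / 2).
have B0 : 0 < B by rewrite ln_gt0//; lra.
have CR x t : x <= B -> exists a b : R,
    has_differential2 u x t a (- b) /\ has_differential2 v x t b a.
  move=> xB; apply/polar_Cauchy_Riemann/dF; first exact: polar_neq0.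
  rewrite rnorm_polar; apply: (@le_lt_trans _ _ (expR B)); first by rewrite ler_expR.
  by rewrite lnK ?posrE//; lra.
have exP t : exists Pt : R -> R, forall x : R, x \in `]X0 - 1, B[ ->
    is_derive x 1 Pt (v x t).
  apply: primitive_exists; apply: continuous_in_subspaceT => x.
  rewrite inE/= in_itv/= => /andP[_ xB].
  by have [a [b [_ /has_differential2_derive1/is_derive_continuous]]] := CR x t xB.
have [P dP] := choice exP.
have exQ x : exists Qx : R -> R, x <= B ->
    forall t : R, t \in `]-1, 2 * pi + 1[ -> is_derive t 1 Qx (u x t).
  have [xB|xB] := leP x B; last by exists (u x).
  have [|Qx HQ] := @primitive_exists R (u x) (-1) (2 * pi + 1).
    apply: continuous_in_subspaceT => t _.
    by have [a [b [/has_differential2_derive2/is_derive_continuous]]] := CR x t xB.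
  by exists Qx.
have [Q dQ] := choice exQ.
have pi0 := pi_gt0 R.
have sub1 (x : R) : x \in `[X0, 0] -> x \in `]X0 - 1, B[ by rewrite !in_itv/=; lra.
have sub2 (t : R) : t \in `[0, 2 * pi] -> t \in `]-1, 2 * pi + 1[ by rewrite !in_itv/=; lra.
have leB x : x \in `[X0, 0] -> x <= B by rewrite in_itv/=; lra.
have p2 : 0 <= 2 * pi :> R by lra.
have hP (x t : R) : x \in `[X0, 0] -> t \in `[0, 2 * pi] ->
    is_derive x 1 (fun x => P t x) (v x t).
  by move=> xI _; exact: (dP t x (sub1 x xI)).
have hQ (x t : R) : x \in `[X0, 0] -> t \in `[0, 2 * pi] -> is_derive t 1 (Q x) (u x t).
  move=> xI tI. exact: (dQ x (leB x xI) t (sub2 t tI)).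
have hc (x t : R) : x \in `[X0, 0] -> t \in `[0, 2 * pi] ->
    exists px py qy, has_differential2 v x t px py /\ has_differential2 u x t py qy.
  move=> xI _; have [a [b [d1 d2]]] := CR x t (leB x xI).
  by exists b, a, (- b).
(* The form is v dx + u dt; it is closed by the Cauchy-Riemann equation dv/dt = du/dx. *)
have ce := @circulation_eq0 R v u (fun x t => P t x) Q X0 0 0 (2 * pi)
  (ltW X00) p2 hP hQ hc.
have I0 : 0 \in `[X0, 0] by rewrite in_itv/= lexx ltW.
have IX : X0 \in `[X0, 0] by rewrite in_itv/= lexx ltW.
have J0 : (0 : R) \in `[0, 2 * pi] by rewrite in_itv/= lexx p2.
have J1 : (2 * pi : R) \in `[0, 2 * pi] by rewrite in_itv/= lexx p2.
have [s _ sE] := mvt_derive p2 (fun t tI => hQ 0 t I0 tI).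
have [t _ tE] := mvt_derive p2 (fun t tI => hQ X0 t IX tI).
have [x _ xE] := mvt_derive (ltW X00)
  (fun x xI => is_deriveB (hP x (2 * pi) xI J1) (hP x 0 xI J0)).
(* By periodicity the sides [t = 0] and [t = 2 * pi] cancel, so the integrals of [u] over the two
   circles agree. *)
have v0 : v x (2 * pi) = v x 0.
  by rewrite /v /polar mulr_natl cos2pi sin2pi cos0 sin0.
have {}xE : P (2 * pi) 0 - P 0 0 - (P (2 * pi) X0 - P 0 X0)
    = (v x (2 * pi) - v x 0) * (0 - X0) := xE.
rewrite v0 subrr mul0r in xE; rewrite !subr0 in sE tE.
rewrite /circulation in ce.
exists t, s; rewrite -/(u X0 t) -/(u 0 s).
have pi20 : 2 * pi != 0 :> R by rewrite gt_eqF// mulr_gt0.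
apply: (mulIf pi20); rewrite -sE -tE.
by move: ce xE; clear; lra.
Qed.

(* [F] need not be differentiable at the centre; this is what lets the lemma
   apply to difference quotients. *)
Lemma Re_maximum_principle F (M : R) :
  (forall z, z != 0 -> rnorm z < 2 -> differentiable F z) ->
  {for 0, continuous F} ->
  (forall z, rnorm z = 1 -> complex.Re (F z) <= M) -> complex.Re (F 0) <= M.
Proof.
move=> dF cF FM; apply/ler_addgt0Pr => e e0.
have [r r0 rP] := (continuous_rnormP F 0).1 cF e e0.
(* The circle of radius [Num.min r 1 / 2] lies inside the unit circle and where [F] is within [e] of
   [F 0]. *)
pose X0 : R := ln (Num.min r 1 / 2).
have m0 : 0 < Num.min r 1 by rewrite lt_min r0 ltr01.
have m1 : Num.min r 1 <= 1 by rewrite ge_min lexx orbT.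
have X0E : expR X0 = Num.min r 1 / 2 by rewrite lnK// posrE divr_gt0.
have X00 : X0 < 0 by rewrite -expR_lt1 X0E; lra.
have [t [s ts]] := circle_mean X00 dF.
have Fs : complex.Re (F (polar 0 s)) <= M by apply: FM; rewrite rnorm_polar expR0.
have zr : rnorm (polar X0 t - 0) < r.
  rewrite subr0 rnorm_polar X0E; apply: (@lt_le_trans _ _ (Num.min r 1)); last by rewrite ge_min lexx.
  by rewrite ltr_pdivrMr// ltr_pMr// ltr1n.
have := le_lt_trans (Re_le_rnorm _) (rP _ zr).
have -> : complex.Re (F (polar X0 t) - F 0) = complex.Re (F (polar X0 t)) - complex.Re (F 0).
  by case: (F _) => ? ?; case: (F 0).
by rewrite ltr_norml => /andP[+ _]; move: Fs; rewrite -ts; lra.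
Qed.

End MaximumPrinciple.

(** * The comparison function *)

Section Vectors.
Variables (R : realType) (m : nat).
Implicit Types z : 'rV[R[i]]_m.
Local Open Scope complex_scope.

Lemma rnorm_coord z j : rnorm (z ord0 j) <= rnorm z.
Proof.
rewrite -lecR -!rnormE -[leRHS]/(mx_norm z) mx_normE.
exact: (le_bigmax _ (fun i : 'I_1 * 'I_m => `|z i.1 i.2|%:nng) (ord0, j)).
Qed.

Lemma rnorm_coord_le z (r : R) : 0 <= r ->
  (forall j, rnorm (z ord0 j) <= r) -> rnorm z <= r.
Proof.
move=> r0 zr; rewrite -lecR -rnormE -[leLHS]/(mx_norm z) mx_normE.
have rc0 : 0 <= r%:C by rewrite ler0c.
rewrite -[leRHS]/((NngNum rc0)%:num) num_le; apply/bigmax_leP.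
split=> [|[i j] _]; first by rewrite -num_le/=.
by rewrite -num_le/= ord1 rnormE lecR.
Qed.

Lemma differentiable_line n (H : 'rV[R[i]]_m -> 'rV[R[i]]_n) z v (s : R[i]) j :
  differentiable H (z + s *: v) ->
  differentiable (fun t : R[i] => H (z + t *: v) ord0 j) s.
Proof.
move=> dH.
have dl : differentiable (fun t : R[i] => z + t *: v) s.
  apply: differentiableD; first exact: differentiable_cst.
  by apply: differentiableZl.
have dHl : differentiable (H \o (fun t : R[i] => z + t *: v)) s.
  exact: differentiable_comp.
exact: (differentiable_comp dHl (@differentiable_coord _ _ _ _ ord0 j)).
Qed.

(** An invertible [L] allows a preimage of [b] with [c = 1]; otherwise a kernel vector works with
    [c = 0]. This covers points where the derivative of [H] degenerates. *)
Lemma exists_direction_onto_line (L : {linear 'rV[R[i]]_m -> 'rV[R[i]]_m}) b : b != 0 ->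
  exists v (c : R[i]), [/\ v != 0, rnorm c <= 1 & L v = c *: b].
Proof.
move=> b0; have LE v : L v = v *m lin1_mx L by rewrite mul_rV_lin1.
have [Lu|Lu] := boolP (lin1_mx L \in unitmx).
  exists (b *m invmx (lin1_mx L)), 1; split.
  - apply: contra_neq b0 => bL0.
    by rewrite -[b](mulmxKV Lu) bL0 mul0mx.
  - by rewrite /rnorm normr1.
  - by rewrite LE mulmxKV// scale1r.
have : kermx (lin1_mx L) != 0 by rewrite kermx_eq0 row_free_unit.
move=> /rowV0Pn[v /sub_kermxP vL v0]; exists v, 0; split => //.
  by rewrite rnorm0.
by rewrite LE vL scale0r.
Qed.

End Vectors.

(** * The function phi and the perturbation of the Euclidean norm of the imaginary part *)

Section ComparisonFunction.
Variables (R : realType) (m : nat) (e : 'I_m -> R).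
Implicit Types z : 'rV[R[i]]_m.
Local Open Scope complex_scope.
Local Notation Re := complex.Re.
Local Notation Im := complex.Im.

Definition comparison_term (a : R) (u : R[i]) : R :=
  Im u * a - Re u ^+ 2 + 3 * Im u ^+ 2.

Definition comparison_function z : R := \sum_j comparison_term (e j) (z ord0 j).

Definition Im_norm z : R := Num.sqrt (\sum_j Im (z ord0 j) ^+ 2).

(** From 3 y^2 - x^2 = |z|^2 - 2 Re(z^2) with [z = u + h], and |u + h|^2 expanded. The argument of
    [Re] is a polynomial in [h], since [u] and its conjugate are constants. *)
Lemma comparison_termE (a : R) (u h : R[i]) :
  comparison_term a (u + h) =
  Re (- 'i * a%:C * (u + h) - 2 * (u + h) ^+ 2 + u * u^* + 2 * u^* * h)
  + rnorm h ^+ 2.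
Proof.
rewrite rnorm_sqr /comparison_term; case: u => u1 u2; case: h => h1 h2 /=.
by rewrite !expr2 /=; ring.
Qed.

(* [sqrt x <= (x + l^2) / (2 l)], the tangent at [l^2] with [l = (1 + t) beta]. *)
Lemma Im_norm_perturbation (b w : 'I_m -> R) (beta t : R) :
  0 < beta -> \sum_j b j ^+ 2 = beta ^+ 2 -> `|t| <= 2^-1 ->
  Num.sqrt (\sum_j ((1 + t) * b j + w j) ^+ 2) <=
  (\sum_j b j * ((1 + t) * b j + w j)) / beta + (\sum_j w j ^+ 2) / beta.
Proof.
move=> beta0 bb; rewrite ler_norml => /andP[t1 t2].
pose l := (1 + t) * beta.
have l0 : 0 < l by rewrite mulr_gt0//; lra.
have l2 : 0 < 2 * l by rewrite pmulr_rgt0.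
have -> : \sum_j b j * ((1 + t) * b j + w j) = (1 + t) * beta ^+ 2 + \sum_j b j * w j.
  rewrite -bb mulr_sumr -big_split/=; apply: eq_bigr => j _; ring.
have V0 : 0 <= \sum_j ((1 + t) * b j + w j) ^+ 2.
  by apply: sumr_ge0 => j _; exact: sqr_ge0.
have VE : \sum_j ((1 + t) * b j + w j) ^+ 2 =
    (1 + t) ^+ 2 * beta ^+ 2 + 2 * (1 + t) * \sum_j b j * w j + \sum_j w j ^+ 2.
  rewrite -bb !mulr_sumr -!big_split/=; apply: eq_bigr => j _; ring.
rewrite VE in V0 *.
have W0 : 0 <= \sum_j w j ^+ 2 by apply: sumr_ge0 => j _; exact: sqr_ge0.
set W := \sum_j w j ^+ 2 in V0 W0 *; set S := \sum_j b j * w j in V0 *.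
set V := _ + W in V0 *.
have key : Num.sqrt V <= (V + l ^+ 2) / (2 * l).
  rewrite ler_pdivlMr//.
  have := sqr_ge0 (Num.sqrt V - l); rewrite sqrrB sqr_sqrtr//.
  by move: (Num.sqrt V) => x; lra.
apply: le_trans key _.
have -> : (V + l ^+ 2) / (2 * l) = ((1 + t) * beta ^+ 2 + S) / beta + W / (2 * l).
  by rewrite /V /l; field; rewrite !gt_eqF//; lra.
(* [|t| <= 2^-1] gives [beta <= 2 * l]. *)
rewrite lerD2l ler_wpM2l// lef_pV2 ?posrE//.
by rewrite /l mulrA; apply: ler_peMl; [exact: ltW|lra].
Qed.
End ComparisonFunction.

(** * Absence of interior maxima where [H] is not real *)

Section InteriorMaximum.
Variables (R : realType) (m : nat) (H : 'rV[R[i]]_m -> 'rV[R[i]]_m).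
Variables (e : 'I_m -> R) (C : R).
Implicit Types z : 'rV[R[i]]_m.
Local Open Scope complex_scope.
Local Notation Re := complex.Re.
Local Notation Im := complex.Im.

Lemma ReD (a b : R[i]) : Re (a + b) = Re a + Re b.
Proof. by case: a; case: b. Qed.
Lemma ImD (a b : R[i]) : Im (a + b) = Im a + Im b.
Proof. by case: a; case: b. Qed.
Lemma Re_sum (f : 'I_m -> R[i]) : Re (\sum_j f j) = \sum_j Re (f j).
Proof. by apply: big_morph => [a b|//]; exact: ReD. Qed.

(** On the disc [z0 + h s], subtract |h s|_2^2 from phi and replace |Im H|_2 by its projection on
    the direction of Im H(z0): this is the real part of a holomorphic [F]. It is exact at [s = 0],
    but on [rnorm s = 1] the missing |h s|_2^2 outweighs the norm error, so Re F lies below its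
    central value, against the maximum principle. *)
Lemma no_interior_maximum z0 (d : R) : 0 < d -> 0 <= C ->
  (forall z, rnorm (z - z0) < d -> differentiable H z) ->
  Im_norm (H z0) != 0 ->
  (forall z, rnorm (z - z0) < d ->
    comparison_function e z - C * Im_norm (H z) <=
    comparison_function e z0 - C * Im_norm (H z0)) -> False.
Proof.
move=> d0 C0 dH Hz0 zmax.
set beta := Im_norm (H z0) in Hz0 zmax.
have beta0 : 0 < beta by rewrite lt_neqAle eq_sym Hz0 sqrtr_ge0.
pose b j := Im (H z0 ord0 j).
have bb : \sum_j b j ^+ 2 = beta ^+ 2.
  by rewrite sqr_sqrtr//; apply: sumr_ge0 => j _; exact: sqr_ge0.
pose bc : 'rV[R[i]]_m := \row_j (b j)%:C.
have bc0 : bc != 0.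
  apply: contra_neq Hz0 => bc0; rewrite /beta /Im_norm big1 ?sqrtr0// => j _.
  move/rowP: bc0 => /(_ j); rewrite !mxE => -[bj0].
  by rewrite -/(b j) bj0 expr0n.
have [v [c [v0 c1 Lv]]] := exists_direction_onto_line ('d H z0) bc0.
pose E := \sum_j rnorm (v ord0 j) ^+ 2.
have E0 : 0 < E.
  have [j vj] : exists j, v ord0 j != 0.
    apply: contrapT => /forallNP N; move/eqP: v0; apply; apply/rowP => j.
    by rewrite mxE; apply/eqP/negPn/negP/N.
  rewrite /E (bigD1 j)//= ltr_pwDl// ?exprn_gt0 ?rnorm_gt0//.
  by apply: sumr_ge0 => k _; rewrite sqr_ge0.
have nv0 : 0 < rnorm v by rewrite rnorm_gt0.
(* On [rnorm s = 1] the gain is [rho ^+ 2 * E]; this [eps] makes the error of the norm at most half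
   of it. The factor [m] comes from summing [m] coordinates, each bounded by the sup norm. *)
have [eps eps0 epsE] : exists2 eps : R, 0 < eps &
    C * ((m%:R * (eps * rnorm v) ^+ 2) / beta) <= E / 2.
  pose K := C * m%:R * rnorm v ^+ 2 / beta.
  have K0 : 0 <= K by rewrite divr_ge0 ?mulr_ge0// ltW.
  have K1 : 0 < 2 * (K + 1) by rewrite mulr_gt0// ltr_wpDl.
  exists (Num.min 1 (E / (2 * (K + 1)))); first by rewrite lt_min ltr01 divr_gt0.
  set eps := Num.min _ _.
  have eps0 : 0 < eps by rewrite lt_min ltr01 divr_gt0.
  have eps1 : eps <= 1 by rewrite ge_min lexx.
  have epsK : eps * (2 * (K + 1)) <= E by rewrite -ler_pdivlMr// ge_min lexx orbT.
  have -> : C * (m%:R * (eps * rnorm v) ^+ 2 / beta) = K * eps ^+ 2.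
    by rewrite /K; field; rewrite gt_eqF.
  apply: (@le_trans _ _ (K * eps)); last by lra.
  by rewrite ler_wpM2l// expr2 ler_piMr// ltW.
have z0d : rnorm (z0 - z0) < d by rewrite subrr rnorm0.
have [r r0 rP] := differentiable_rnormP (dH z0 z0d) eps0.
have [rho rho0 [rhod rhor rho1]] : exists2 rho : R, 0 < rho &
    [/\ 2 * (rho * rnorm v) < d, 2 * (rho * rnorm v) < r & rho <= 2^-1].
  have n40 : 0 < 4 * rnorm v by rewrite mulr_gt0.
  exists (Num.min 2^-1 (Num.min (d / (4 * rnorm v)) (r / (4 * rnorm v)))).
    by rewrite !lt_min invr_gt0 ltr0n !divr_gt0.
  set rho := Num.min _ _.
  have rho1 : rho <= d / (4 * rnorm v) by rewrite !ge_min lexx !orbT.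
  have rho2 : rho <= r / (4 * rnorm v) by rewrite !ge_min lexx !orbT.
  split; last by rewrite ge_min lexx.
    by move: rho1; rewrite ler_pdivlMr//; lra.
  by move: rho2; rewrite ler_pdivlMr//; lra.
pose h (s : R[i]) : 'rV[R[i]]_m := s *: (rho%:C *: v).
have hn s : rnorm (h s) = rnorm s * (rho * rnorm v).
  by rewrite !rnormZ rnorm_real ger0_norm// ltW.
pose q j (s : R[i]) : R[i] := - 'i * (e j)%:C * (z0 ord0 j + h s ord0 j)
  - 2 * (z0 ord0 j + h s ord0 j) ^+ 2 + z0 ord0 j * (z0 ord0 j)^*
  + 2 * (z0 ord0 j)^* * h s ord0 j.
(* Multiplication by ['i] turns the imaginary part of [H] into minus a real part. *)
pose f j (s : R[i]) : R[i] := q j s + 'i * (C / beta * b j)%:C * H (z0 + h s) ord0 j.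
pose F (s : R[i]) : R[i] := \sum_j f j s.
have ReF s : Re (F s) = comparison_function e (z0 + h s)
    - \sum_j rnorm (h s ord0 j) ^+ 2
    - C * ((\sum_j b j * Im (H (z0 + h s) ord0 j)) / beta).
  have -> : C * ((\sum_j b j * Im (H (z0 + h s) ord0 j)) / beta) =
      \sum_j C / beta * b j * Im (H (z0 + h s) ord0 j).
    rewrite mulr_suml mulr_sumr; apply: eq_bigr => j _; field.
    by rewrite gt_eqF.
  rewrite /F Re_sum /comparison_function -!sumrB.
  apply: eq_bigr => j _; rewrite /f ReD [in RHS]mxE comparison_termE -/(q j s).
  rewrite addrK; congr (_ + _); by case: (H _ _ _) => x y /=; ring.
have dF s : rnorm s < 2 -> differentiable F s.
  move=> s2.
  have hd : rnorm (z0 + h s - z0) < d.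
    by rewrite addrC addKr hn; apply: lt_trans rhod; rewrite ltr_pM2r// mulr_gt0.
  have -> : F = \sum_(j < m) f j by apply/funext => t; rewrite fct_sumE.
  apply: differentiable_sum => j.
  have dh : differentiable (fun s => h s ord0 j) s.
    have -> : (fun s => h s ord0 j) = (fun s => s * (rho%:C * v ord0 j)).
      by apply/funext => t; rewrite !mxE.
    by apply: differentiableM.
  have du : differentiable (fun s => z0 ord0 j + h s ord0 j) s by apply: differentiableD.
  have dHj : differentiable (fun s => H (z0 + h s) ord0 j) s.
    exact: (differentiable_line (v := rho%:C *: v) j (dH _ hd)).
  rewrite /f /q; apply: differentiableD; last by apply: differentiableM.
  apply: differentiableD; last by apply: differentiableM.
  apply: differentiableD; last exact: differentiable_cst.
  apply: differentiableB; first by apply: differentiableM.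
  apply: differentiableM; first exact: differentiable_cst.
  exact: (differentiableM du du).
have h0 : h 0 = 0 by rewrite /h scale0r.
have ReF0 : Re (F 0) = comparison_function e z0 - C * beta.
  rewrite ReF h0 addr0 big1 ?subr0; last by move=> j _; rewrite mxE rnorm0 expr0n.
  have -> : \sum_j b j * Im (H z0 ord0 j) = beta ^+ 2 by rewrite -bb.
  by rewrite expr2 mulfK.
suff ReF1 s : rnorm s = 1 -> Re (F s) <= comparison_function e z0 - C * beta - rho ^+ 2 * E / 2.
  have := Re_maximum_principle (fun (s : R[i]) _ => @dF s)
    (differentiable_continuous (dF 0 _)) ReF1.
  rewrite rnorm0 ReF0 => /(_ (ltr0n _ 2)).
  by rewrite lerBrDr gerDl leNgt divr_gt0// mulr_gt0// exprn_gt0.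
move=> s1.
have hs : rnorm (h s) = rho * rnorm v by rewrite hn s1 mul1r.
have hr : rnorm (h s) < r by rewrite hs; have := mulr_gt0 rho0 nv0; lra.
have hd : rnorm (z0 + h s - z0) < d.
  by rewrite addrC addKr hs; have := mulr_gt0 rho0 nv0; lra.
have := rP _ hr; set w := H (z0 + h s) - H z0 - _ => wle.
(* By the choice of [v], the imaginary part of [H] moves along [b] only, by the factor [1 + t], up
   to the remainder [w]. *)
pose t := Im (s * rho%:C * c).
have t2 : `|t| <= 2^-1.
  apply: le_trans (Im_le_rnorm _) _; rewrite !rnormM s1 mul1r rnorm_real gtr0_norm//.
  by rewrite -[leRHS]mulr1 ler_pM// ?rnorm_ge0 ?ltW.
have HE j : Im (H (z0 + h s) ord0 j) = (1 + t) * b j + Im (w ord0 j).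
  have -> : H (z0 + h s) = H z0 + (s * rho%:C * c) *: bc + w.
    have <- : 'd H z0 (h s) = (s * rho%:C * c) *: bc.
      by rewrite /h !linearZ /= Lv !scalerA.
    by rewrite /w -[H (z0 + h s) - _ - _]addrA -opprD [RHS]addrC subrK.
  rewrite !mxE !ImD mulrDl mul1r -/(b j); congr (_ + _ + _).
  by rewrite /t; case: (s * _ * _) => x y /=; rewrite mulr0 add0r.
have := Im_norm_perturbation (fun j => Im (w ord0 j)) beta0 bb t2.
have -> : \sum_j b j * ((1 + t) * b j + Im (w ord0 j)) =
    \sum_j b j * Im (H (z0 + h s) ord0 j) by apply: eq_bigr => j _; rewrite HE.
have -> : \sum_j ((1 + t) * b j + Im (w ord0 j)) ^+ 2 =
    \sum_j Im (H (z0 + h s) ord0 j) ^+ 2 by apply: eq_bigr => j _; rewrite HE.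
rewrite -/(Im_norm _) => perturb.
have W : \sum_j Im (w ord0 j) ^+ 2 <= rho ^+ 2 * (m%:R * (eps * rnorm v) ^+ 2).
  have -> : rho ^+ 2 * (m%:R * (eps * rnorm v) ^+ 2) =
      \sum_(j < m) (eps * (rho * rnorm v)) ^+ 2.
    by rewrite sumr_const card_ord -mulr_natl; ring.
  apply: ler_sum => j _; rewrite -[leLHS]real_normK ?num_real//.
  rewrite ler_pXn2r ?nnegrE ?mulr_ge0//; try exact: ltW.
  rewrite -hs; apply: le_trans wle; apply: le_trans (rnorm_coord _ j).
  exact: Im_le_rnorm.
have hE : \sum_j rnorm (h s ord0 j) ^+ 2 = rho ^+ 2 * E.
  rewrite /E mulr_sumr; apply: eq_bigr => j _.
  by rewrite !mxE !rnormM s1 mul1r rnorm_real gtr0_norm// exprMn.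
rewrite ReF hE.
have := zmax _ hd.
set G := Im_norm (H _) in perturb *; set S := (_ / beta) in perturb *.
move=> Zm.
have CW : C * ((\sum_j Im (w ord0 j) ^+ 2) / beta) <= rho ^+ 2 * (E / 2).
  apply: (@le_trans _ _ (C * (rho ^+ 2 * (m%:R * (eps * rnorm v) ^+ 2) / beta))).
    by rewrite ler_wpM2l// ler_pM2r// invr_gt0.
  rewrite -mulrA [C * _]mulrCA ler_wpM2l// exprn_ge0// ltW//.
have := ler_wpM2l C0 perturb; rewrite mulrDr.
by move: CW Zm; clear; lra.
Qed.
End InteriorMaximum.

(** * Compactness of balls *)

Section Continuity.
Variables (R : realType).
Local Open Scope complex_scope.
Local Notation Re := complex.Re.
Local Notation Im := complex.Im.

Lemma continuous_rnorm_le (V : normedModType R[i]) (f : V -> R) (x : V) :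
  (forall y, `|f y - f x| <= rnorm (y - x)) -> {for x, continuous f}.
Proof.
move=> fle; apply/cvgrPdist_lt => e e0.
apply/nbhs_rnormP; exists e => // y; apply: le_lt_trans.
by rewrite distrC.
Qed.

Lemma continuous_rnorm (V : normedModType R[i]) : continuous (@rnorm R V).
Proof.
move=> x; apply: continuous_rnorm_le => y; rewrite ler_norml; apply/andP; split.
  have := rnorm_triangle (x - y) y; rewrite subrK rdistC; lra.
have := rnorm_triangle (y - x) x; rewrite subrK; lra.
Qed.

Lemma continuous_Re : continuous (@complex.Re R).
Proof.
move=> x; apply: continuous_rnorm_le => y; apply: le_trans (Re_le_rnorm _).
by case: x y => [? ?] [? ?].
Qed.

Lemma continuous_Im : continuous (@complex.Im R).
Proof.
move=> x; apply: continuous_rnorm_le => y; apply: le_trans (Im_le_rnorm _).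
by case: x y => [? ?] [? ?].
Qed.

Lemma continuous_for_sum (T : topologicalType) m (f : 'I_m -> T -> R) (x : T) :
  (forall j, {for x, continuous (f j)}) ->
  {for x, continuous (fun z => \sum_j f j z)}.
Proof.
move=> cf; have -> : (fun z => \sum_j f j z) = \sum_j f j.
  by apply/funext => z; rewrite fct_sumE.
apply: (big_ind (fun g : T -> R => {for x, continuous g})) => //.
  exact: cst_continuous.
by move=> g h cg ch; exact: continuousD.
Qed.

Lemma continuous_Im_norm m : continuous (@Im_norm R m).
Proof.
move=> z; apply: (@continuous_comp _ _ _ _ Num.sqrt); last exact: sqrt_continuous.
apply: continuous_for_sum => j.
have ci : {for z, continuous (fun z : 'rV[R[i]]_m => Im (z ord0 j))}.
  exact: (@continuous_comp _ _ _ _ (@complex.Im R) _ (@coord_continuous _ _ _ ord0 j z) (@continuous_Im _)).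
exact: (continuousM ci ci).
Qed.

Lemma continuous_comparison_function m (e : 'I_m -> R) :
  continuous (comparison_function e).
Proof.
move=> z; apply: continuous_for_sum => j; rewrite /comparison_term.
have ci : {for z, continuous (fun z : 'rV[R[i]]_m => Im (z ord0 j))}.
  exact: (@continuous_comp _ _ _ _ (@complex.Im R) _ (@coord_continuous _ _ _ ord0 j z) (@continuous_Im _)).
have cr : {for z, continuous (fun z : 'rV[R[i]]_m => Re (z ord0 j))}.
  exact: (@continuous_comp _ _ _ _ (@complex.Re R) _ (@coord_continuous _ _ _ ord0 j z) (@continuous_Re _)).
have cst (a : R) : {for z, continuous (fun _ : 'rV[R[i]]_m => a)} by exact: cst_continuous.
apply: continuousD; last exact: (continuousM (cst 3) (continuousM ci ci)).
apply: continuousB; last exact: (continuousM cr cr).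
exact: (continuousM ci (cst _)).
Qed.

Lemma closed_rnorm_le (V : normedModType R[i]) (r : R) :
  closed [set z : V | rnorm z <= r].
Proof.
apply: (@preimage_closed _ _ (@rnorm R V) [set x | x <= r]); last exact: closed_le.
by move=> z _; exact: continuous_rnorm.
Qed.

Lemma compact_disc (r : R) : compact [set u : R[i] | rnorm u <= r].
Proof.
pose f (p : R * R) : R[i] := p.1 +i* p.2.
have cf : continuous f.
  move=> [x y] A /nbhs_rnormP[e e0 eA].
  have e2 : 0 < e / 2 by lra.
  near=> p; apply: eA; apply: le_lt_trans (rnorm_le_ReIm _) _.
  have -> : e = e / 2 + e / 2 by lra.
  apply: ltrD => /=; near: p.
    have : (fun p : R * R => p.1) p @[p --> (x, y)] --> x by exact: cvg_fst.
    by move=> /cvgrPdist_lt/(_ _ e2); apply: filterS => p; rewrite distrC.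
  have : (fun p : R * R => p.2) p @[p --> (x, y)] --> y by exact: cvg_snd.
  by move=> /cvgrPdist_lt/(_ _ e2); apply: filterS => p; rewrite distrC.
have K : compact (`[- r, r]%classic `*` `[- r, r]%classic : set (R * R)).
  by apply: compact_setX; exact: segment_compact.
have K' := continuous_compact (continuous_subspaceT cf) K.
have cl := @closed_rnorm_le R[i] r.
apply: (subclosed_compact cl K').
move=> [x y] /= xy; exists (x, y) => //=; rewrite !in_itv/= -!ler_norml.
split.
  by apply: le_trans xy; exact: (Re_le_rnorm (x +i* y)).
by apply: le_trans xy; exact: (Im_le_rnorm (x +i* y)).
Unshelve. all: by end_near. Qed.

Lemma compact_ball m (r : R) : 0 <= r -> compact [set z : 'rV[R[i]]_m | rnorm z <= r].
Proof.
move=> r0; have := @rV_compact R[i] m _ (fun=> @compact_disc r).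
congr compact; apply/seteqP; split=> z /= zr; first exact: rnorm_coord_le.
by move=> j; apply: le_trans (rnorm_coord _ j) zr.
Qed.
End Continuity.

(** * Injectivity of the derivative *)

Section Kernel.
Variables (R : realType) (m : nat).
Implicit Types z : 'rV[R[i]]_m.
Local Open Scope complex_scope.
Local Notation Re := complex.Re.
Local Notation Im := complex.Im.

Lemma Im_norm_ge0 z : 0 <= Im_norm z.
Proof. exact: sqrtr_ge0. Qed.

Lemma Im_norm_eq0 z : (Im_norm z = 0) <-> forall j, Im (z ord0 j) = 0.
Proof.
split=> [/eqP|z0].
  rewrite sqrtr_eq0 => s0 j.
  have : \sum_j Im (z ord0 j) ^+ 2 == 0.
    by rewrite eq_le s0/= sumr_ge0// => k _; exact: sqr_ge0.
  rewrite psumr_eq0; last by move=> k _; exact: sqr_ge0.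
  by move=> /allP/(_ j); rewrite mem_index_enum sqrf_eq0 => /(_ isT)/eqP.
by rewrite /Im_norm big1 ?sqrtr0// => j _; rewrite z0 expr0n.
Qed.

Lemma Im_norm_le z : Im_norm z <= Num.sqrt m%:R * rnorm z.
Proof.
rewrite -[rnorm z]ger0_norm ?rnorm_ge0// -sqrtr_sqr -sqrtrM ?ler0n//.
have -> : m%:R * rnorm z ^+ 2 = \sum_(j < m) rnorm z ^+ 2.
  by rewrite sumr_const card_ord mulr_natl.
rewrite ler_wsqrtr// ler_sum// => j _; rewrite -[leLHS]real_normK ?num_real//.
rewrite ler_pXn2r ?nnegrE ?rnorm_ge0//.
exact: le_trans (Im_le_rnorm _) (rnorm_coord z j).
Qed.

Variables (H : 'rV[R[i]]_m -> 'rV[R[i]]_m) (r : R).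
Hypotheses (r0 : 0 < r) (dH : forall z, rnorm z <= r -> differentiable H z).
Hypothesis H0 : H 0 = 0.
Hypothesis Hreal : forall z, rnorm z <= r -> Im_norm (H z) = 0 -> Im_norm z = 0.

Lemma comparison_function_real (e : 'I_m -> R) z : Im_norm z = 0 ->
  comparison_function e z = - \sum_j Re (z ord0 j) ^+ 2.
Proof.
move=> /Im_norm_eq0 z0; rewrite -sumrN; apply: eq_bigr => j _.
by rewrite /comparison_term z0; ring.
Qed.

(** Compactness yields [C]: on the part [S] of the sphere where phi >= 0, |Im H|_2 has a positive
    minimum [c], and [M / c] suffices there if [M] bounds phi. A maximum point of the difference
    over the ball is on the sphere, or has [H] real, hence phi <= 0, or contradicts
    [no_interior_maximum]. *)
Lemma comparison_function_le (e : 'I_m -> R) : exists C : R, forall z, rnorm z <= r ->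
  comparison_function e z <= C * Im_norm (H z).
Proof.
have cPhi := @continuous_comparison_function R m e.
have cImH z : rnorm z <= r -> {for z, continuous (fun z => Im_norm (H z))}.
  move=> zr; apply: (@continuous_comp _ _ _ H (@Im_norm R m)).
    exact: differentiable_continuous (dH zr).
  exact: continuous_Im_norm.
pose K := [set z : 'rV[R[i]]_m | rnorm z <= r].
have cK : compact K by apply: compact_ball; exact: ltW.
have K0 : K 0 by rewrite /K/= rnorm0 ltW.
pose S := K `&` (@rnorm R _ @^-1` [set x | r <= x] `&` comparison_function e @^-1` [set x | 0 <= x]).
have cS : compact S.
  have cl : closed S.
    apply: closedI; first exact: closed_rnorm_le.
    apply: closedI; apply: preimage_closed; try exact: closed_ge.
      by move=> z _; exact: continuous_rnorm.
    by move=> z _; exact: cPhi.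
  by apply: (subclosed_compact cl cK) => z [].
have Kne : K !=set0 by exists 0.
have [M [M0 MP]] : exists M : R, 0 <= M /\
    forall z, rnorm z <= r -> comparison_function e z <= M.
  have [z _ zP] := compact_EVT_max Kne cK (continuous_subspaceT cPhi).
  exists (Num.max 0 (comparison_function e z)); split; first by rewrite le_max lexx.
  move=> y yr; rewrite le_max; apply/orP; right; apply: zP; exact/mem_set.
have [c c0 cP] : exists2 c : R, 0 < c & forall z, S z -> c <= Im_norm (H z).
  have [S0|S0] := pselect (S !=set0); last first.
    by exists 1 => // z Sz; exfalso; apply: S0; exists z.
  have cS' : {within S, continuous (fun z => Im_norm (H z))}.
    by apply: continuous_in_subspaceT => z; rewrite inE => -[zr _]; exact: cImH.
  have [z zS zP] := compact_EVT_min S0 cS cS'.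
  exists (Im_norm (H z)); last by move=> y Sy; apply: zP; exact/mem_set.
  rewrite lt_neqAle Im_norm_ge0 andbT eq_sym; apply/negP => /eqP Hz.
  move: zS; rewrite inE => -[zr [/= zr' zp]].
  have Iz := Hreal zr Hz.
  (* At a real point phi >= 0 forces every coordinate to vanish, but 0 is not on the sphere. *)
  move: zp; rewrite comparison_function_real// oppr_ge0 => s0.
  suff z0 : z = 0 by move: zr'; rewrite z0 rnorm0 leNgt r0.
  have : \sum_j Re (z ord0 j) ^+ 2 == 0.
    by rewrite eq_le s0/= sumr_ge0// => k _; exact: sqr_ge0.
  rewrite psumr_eq0; last by move=> k _; exact: sqr_ge0.
  move=> /allP Rz; apply/rowP => j; rewrite mxE.
  have := Rz j; rewrite mem_index_enum sqrf_eq0 => /(_ isT)/eqP Rzj.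
  have /Im_norm_eq0/(_ j) := Iz; move: Rzj.
  by case: (z ord0 j) => x y /= -> ->.
pose C := M / c.
have C0 : 0 <= C by rewrite divr_ge0// ltW.
exists C => z zr.
have cK' : {within K, continuous (fun z => comparison_function e z - C * Im_norm (H z))}.
  apply: continuous_in_subspaceT => y; rewrite inE => yr.
  apply: continuousB; first exact: cPhi.
  apply: (continuousM _ (cImH y yr)); exact: cst_continuous.
have [z0 z0K z0max] := compact_EVT_max Kne cK cK'.
rewrite inE/K/= in z0K.
rewrite -subr_le0; apply: le_trans (z0max z (mem_set zr)) _.
have [rz0|z0r] := leP r (rnorm z0).
  have [p0|p0] := leP 0 (comparison_function e z0); last first.
    by rewrite subr_le0; apply: le_trans (ltW p0) _; rewrite mulr_ge0// Im_norm_ge0.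
  have := cP z0 (conj z0K (conj rz0 p0)).
  rewrite subr_le0 => cI; apply: le_trans (MP _ z0K) _.
  by rewrite /C -mulrA ler_peMr// mulrC ler_pdivlMr// mul1r.
have [Hz0|Hz0] := eqVneq (Im_norm (H z0)) 0.
  have Iz0 := Hreal z0K Hz0.
  rewrite Hz0 mulr0 subr0 (comparison_function_real _ Iz0) oppr_le0.
  by apply: sumr_ge0 => j _; exact: sqr_ge0.
exfalso; have d0 : 0 < r - rnorm z0 by rewrite subr_gt0.
have near z' : rnorm (z' - z0) < r - rnorm z0 -> rnorm z' <= r.
  by have := rnorm_triangle (z' - z0) z0; rewrite subrK; lra.
apply: (no_interior_maximum d0 C0 _ Hz0) => z' /near z'r; first exact: dH.
by apply: z0max; exact/mem_set.
Qed.

Lemma derivative_injective v : 'd H 0 v = 0 -> v = 0.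
Proof.
move=> Hv; apply/eqP/negPn/negP => v0.
(* A real [v] is replaced by ['i *: v], also in the kernel, whose imaginary part is [v]. *)
wlog vI : v v0 Hv / Im_norm v != 0.
  have [vI|vI] := eqVneq (Im_norm v) 0; last by move=> /(_ v v0 Hv vI).
  apply.
  - by instantiate (1 := 'i *: v); rewrite scaler_eq0 negb_or v0 andbT eq_complex /= eqxx oner_eq0.
  - by rewrite linearZ /= Hv scaler0.
  apply: contra_neq v0 => /Im_norm_eq0 viI; have /Im_norm_eq0 vI' := vI.
  apply/rowP => j; have := viI j; have := vI' j; rewrite !mxE.
  by case: (v ord0 j) => x y /= ->; rewrite mul0r mul1r add0r => ->.
pose e j := Im (v ord0 j).
have [C CP] := comparison_function_le e.
pose S := \sum_j e j ^+ 2; pose T := \sum_j Re (v ord0 j) ^+ 2.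
have T0 : 0 <= T by apply: sumr_ge0 => j _; exact: sqr_ge0.
have S0 : 0 < S.
  rewrite lt_neqAle sumr_ge0 ?andbT; last by move=> j _; exact: sqr_ge0.
  by apply: contra_neq vI => S0; rewrite /Im_norm -/S -S0 sqrtr0.
have nv : 0 < rnorm v by rewrite rnorm_gt0.
pose D := `|C| * Num.sqrt m%:R * rnorm v.
have D0 : 0 <= D by rewrite !mulr_ge0 ?sqrtr_ge0// ltW.
have eps0 : 0 < S / (4 * (D + 1)) by rewrite divr_gt0// mulr_gt0// ltr_wpDl.
have rr0 : rnorm (0 : 'rV[R[i]]_m) <= r by rewrite rnorm0 ltW.
have [d d0 dP] := differentiable_rnormP (dH rr0) eps0.
set eps := S / _ in eps0 dP.
have epsD : D * eps <= S / 4.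
  rewrite /eps mulrA ler_pdivrMr ?mulr_gt0 ?ltr_wpDl//.
  have -> : S / 4 * (4 * (D + 1)) = D * S + S by field.
  by rewrite lerDl ltW.
(* The three bounds give [t * T <= S / 4], keep [t v] in the ball, and keep it where the derivative
   approximates [H] up to [eps]. *)
pose t := Num.min (S / (4 * (T + 1))) (Num.min (r / rnorm v) (d / (2 * rnorm v))).
have t0 : 0 < t.
  by rewrite !lt_min !divr_gt0// ?mulr_gt0// ltr_wpDl.
have t1 : t * (4 * (T + 1)) <= S.
  by rewrite -ler_pdivlMr ?mulr_gt0 ?ltr_wpDl// ge_min lexx.
have t2 : t * rnorm v <= r by rewrite -ler_pdivlMr// !ge_min lexx !orbT.
have t3 : t * rnorm v < d.
  apply: (@le_lt_trans _ _ (d / 2)); last by lra.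
  have : t <= d / (2 * rnorm v) by rewrite !ge_min lexx !orbT.
  by rewrite ler_pdivlMr ?mulr_gt0//; lra.
have tn : rnorm (t%:C *: v) = t * rnorm v by rewrite rnormZ rnorm_real gtr0_norm.
have := dP (t%:C *: v); rewrite tn => /(_ t3).
rewrite add0r H0 subr0 linearZ /= Hv scaler0 subr0 => Hle.
have := CP (t%:C *: v); rewrite tn => /(_ t2).
have -> : comparison_function e (t%:C *: v) = t * S - t ^+ 2 * T + 3 * t ^+ 2 * S.
  rewrite /comparison_function /S /T !mulr_sumr -sumrB -big_split/=.
  apply: eq_bigr => j _; rewrite /comparison_term !mxE /e.
  by case: (v ord0 j) => x y /=; ring.
move=> main.
have CI : C * Im_norm (H (t%:C *: v)) <= t * (D * eps).
  apply: (@le_trans _ _ (`|C| * (Num.sqrt m%:R * (eps * (t * rnorm v))))); last first.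
    by rewrite /D le_eqVlt; apply/orP; left; apply/eqP; ring.
  apply: le_trans (ler_wpM2r (Im_norm_ge0 _) (ler_norm C)) _.
  rewrite ler_wpM2l//; apply: le_trans (Im_norm_le _) _.
  by rewrite ler_wpM2l// sqrtr_ge0.
(* After division by [t] the left side is at least [3 * S / 4], the right side is [S / 4]. *)
have : t * (S - t * T + 3 * (t * S)) <= t * (S / 4).
  apply: le_trans (ler_wpM2l (ltW t0) epsD).
  by apply: le_trans CI; apply: le_trans main; rewrite le_eqVlt; apply/orP; left; apply/eqP; ring.
rewrite ler_pM2l//; have := mulr_gt0 t0 S0.
by move: t1 S0 t0; clear; lra.
Qed.

End Kernel.

(** * Cauchy's estimate *)

Section Cauchy.
Variable R : realType.
Local Open Scope complex_scope.
Local Notation Re := complex.Re.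
Local Notation Im := complex.Im.

(** Take [a] to be the conjugate of [u] divided by its modulus. This reduces bounds on moduli to
    bounds on real parts, which the maximum principle and the real mean value theorem provide. *)
Lemma rnorm_le_Re (u : R[i]) (M : R) : 0 <= M ->
  (forall a : R[i], rnorm a = 1 -> Re (a * u) <= M) -> rnorm u <= M.
Proof.
move=> M0 uM; have [->|u0] := eqVneq u 0; first by rewrite rnorm0.
have n0 : 0 < rnorm u by rewrite rnorm_gt0.
have nJ : rnorm (u^*) = rnorm u by rewrite !rnorm_sqrtE; case: (u) => x y /=; rewrite sqrrN.
have := uM ((rnorm u)^-1%:C * u^*).
rewrite rnormM rnorm_real nJ gtr0_norm ?invr_gt0// mulVf ?gt_eqF// => /(_ erefl).
have -> : Re ((rnorm u)^-1%:C * u^* * u) = (rnorm u)^-1 * rnorm u ^+ 2.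
  by rewrite rnorm_sqr; case: (u) => x y /=; ring.
by rewrite expr2 mulKf// gt_eqF.
Qed.

Lemma near_eq_differentiable (V W : normedModType R[i]) (f g : V -> W) x (r : R) :
  0 < r -> (forall y, rnorm (y - x) < r -> f y = g y) ->
  differentiable f x -> differentiable g x.
Proof.
move=> r0 fg df; apply: (fun cL fL => (rnormP_diff (L := 'd f x) cL fL).1).
  exact: diff_continuous.
move=> e e0; have [d d0 dP] := differentiable_rnormP df e0.
exists (Num.min d r); first by rewrite lt_min d0.
move=> h; rewrite lt_min => /andP[hd hr].
by rewrite -!fg ?subrr ?rnorm0 ?dP// addrC addKr.
Qed.

(** Maximum principle for the difference quotient (f(s) - f(0)) / s, extended continuously by [d] at
    0 and rotated by [a]. *)
Lemma Cauchy_estimate1 (f : R[i] -> R[i]) (d : R[i]) (M : R) : 0 <= M ->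
  (forall s, rnorm s < 2 -> differentiable f s) ->
  (forall e : R, 0 < e -> exists2 r : R, 0 < r &
    forall s, rnorm s < r -> rnorm (f s - f 0 - d * s) <= e * rnorm s) ->
  (forall s, rnorm s = 1 -> rnorm (f s - f 0) <= M) -> rnorm d <= M.
Proof.
move=> M0 df fd fM; apply: rnorm_le_Re => // a a1.
pose k (s : R[i]) : R[i] := if s == 0 then d else (f s - f 0) * s^-1.
have k0 : k 0 = d by rewrite /k eqxx.
have -> : a * d = (fun s => a * k s) 0 by rewrite k0.
apply: (@Re_maximum_principle _ (fun s => a * k s)).
- move=> s s0 s2; have ns : 0 < rnorm s by rewrite rnorm_gt0.
  apply: (near_eq_differentiable (f := fun s => a * ((f s - f 0) * s^-1)) ns).
    move=> y ys; rewrite /k; case: eqP ys => [->|//].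
    by rewrite sub0r rnormN ltxx.
  apply: differentiableM; first exact: differentiable_cst.
  apply: differentiableM.
    by apply: differentiableB; [exact: df|exact: differentiable_cst].
  exact: (differentiable_Rinv s0).
- apply/continuous_rnormP => e e0; rewrite k0.
  have e2 : 0 < e / 2 by lra.
  have [r r0 rP] := fd _ e2.
  exists r => // s; rewrite subr0 => /rP H.
  rewrite -mulrBr rnormM a1 mul1r /k; case: eqP => [_|/eqP s0].
    by rewrite subrr rnorm0.
  have ns : 0 < rnorm s by rewrite rnorm_gt0.
  have -> : (f s - f 0) * s^-1 - d = (f s - f 0 - d * s) * s^-1.
    by rewrite [RHS]mulrBl mulfK.
  by rewrite rnormM rnormV ltr_pdivrMr//; apply: le_lt_trans H _; rewrite ltr_pM2r//; lra.
- move=> s s1; apply: le_trans (ler_norm _) _; apply: le_trans (Re_le_rnorm _) _.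
  rewrite rnormM a1 mul1r /k.
  case: eqP s1 => [->|_ s1]; first by rewrite rnorm0 => /eqP; rewrite eq_sym oner_eq0.
  by rewrite rnormM rnormV s1 invr1 mulr1 fM.
Qed.

(** Rescale [v] to norm [r / 4]: for [rnorm s < 2] the line through [z] stays in the ball, as r/2 +
    2 r/4 = r. The one-variable estimate then gives [2 * M] in each coordinate. *)
Lemma Cauchy_estimate m n (f : 'rV[R[i]]_m -> 'rV[R[i]]_n) (M r : R) : 0 < r -> 0 <= M ->
  (forall z, rnorm z < r -> differentiable f z) ->
  (forall z, rnorm z < r -> rnorm (f z) <= M) ->
  forall z v, rnorm z <= r / 2 -> rnorm ('d f z v) <= 8 * M / r * rnorm v.
Proof.
move=> r0 M0 df fM z v zr.
have [->|v0] := eqVneq v 0; first by rewrite linear0 !rnorm0 mulr0.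
have nv : 0 < rnorm v by rewrite rnorm_gt0.
pose c : R := r / (4 * rnorm v).
have c0 : 0 < c by rewrite divr_gt0// mulr_gt0.
have cv : rnorm (c%:C *: v) = r / 4.
  by rewrite rnormZ rnorm_real gtr0_norm// /c; field; rewrite gt_eqF.
have inball (s : R[i]) : rnorm s < 2 -> rnorm (z + s *: (c%:C *: v)) < r.
  move=> s2; apply: le_lt_trans (rnorm_triangle _ _) _.
  rewrite rnormZ cv; apply: (@lt_le_trans _ _ (r / 2 + 2 * (r / 4))).
    by apply: ler_ltD => //; rewrite ltr_pM2r// divr_gt0.
  by lra.
have key : rnorm ('d f z (c%:C *: v)) <= 2 * M.
  apply: rnorm_coord_le; first lra.
  move=> j.
  pose g (s : R[i]) : R[i] := f (z + s *: (c%:C *: v)) ord0 j.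
  have dg (s : R[i]) : rnorm s < 2 -> differentiable g s.
    by move=> s2; apply: differentiable_line; apply: df; exact: inball.
  have n02 : rnorm (0 : R[i]) < 2 by rewrite rnorm0.
  apply: (@Cauchy_estimate1 g) => //; first lra; last first.
    move=> s s1; apply: le_trans (rnorm_triangleB _ _) _.
    have -> : 2 * M = M + M by lra.
    apply: lerD; apply: le_trans (rnorm_coord _ j) _; apply: fM; apply: inball => //.
    by rewrite s1 ltr1n.
  move=> e e0; have zr' : rnorm z < r by lra.
  have n1 : 0 < rnorm (c%:C *: v) by rewrite cv divr_gt0.
  have e1 : 0 < e / rnorm (c%:C *: v) by rewrite divr_gt0.
  have [d d0 dP] := differentiable_rnormP (df z zr') e1.
  exists (d / rnorm (c%:C *: v)); first by rewrite divr_gt0.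
  move=> s; rewrite ltr_pdivlMr// -rnormZ => /dP.
  rewrite (rnormZ s) mulrA mulrAC divfK ?gt_eqF// => H; apply: le_trans H.
  apply: le_trans (rnorm_coord _ j); rewrite /g.
  have -> : 'd f z (s *: (c%:C *: v)) = s *: 'd f z (c%:C *: v) by exact: linearZ.
  by rewrite scale0r addr0 !mxE [s * 'd f z _ _ _]mulrC.
have : rnorm ('d f z (c%:C *: v)) = c * rnorm ('d f z v).
  by rewrite linearZ rnormZ rnorm_real gtr0_norm.
move=> E; rewrite E in key.
have -> : 8 * M / r * rnorm v = 2 * M / c by rewrite /c; field; rewrite !gt_eqF.
by rewrite ler_pdivlMr// mulrC.
Qed.

Lemma rnorm_sum n (f : 'I_n -> R[i]) : rnorm (\sum_j f j) <= \sum_j rnorm (f j).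
Proof.
apply: (big_ind2 (fun (u : R[i]) (x : R) => rnorm u <= x)) => //.
  by rewrite rnorm0.
by move=> u x v y ux vy; apply: le_trans (rnorm_triangle _ _) (lerD ux vy).
Qed.

Lemma mulmx_bounded m n (B : 'M[R[i]]_(m, n)) : exists2 K : R, 0 <= K &
  forall w : 'rV_m, rnorm (w *m B) <= K * rnorm w.
Proof.
exists (\sum_k \sum_j rnorm (B k j)).
  by apply: sumr_ge0 => k _; apply: sumr_ge0 => j _; exact: rnorm_ge0.
move=> w; apply: rnorm_coord_le => [|j].
  by rewrite mulr_ge0 ?rnorm_ge0//; apply: sumr_ge0 => k _; apply: sumr_ge0 => j _; exact: rnorm_ge0.
rewrite mxE mulr_suml.
apply: le_trans (rnorm_sum _) _; apply: ler_sum => k _.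
rewrite rnormM mulrC; apply: ler_pM; rewrite ?rnorm_ge0// ?rnorm_coord//.
rewrite (bigD1 j)//= lerDl; apply: sumr_ge0 => i _; exact: rnorm_ge0.
Qed.
End Cauchy.

(** * The inverse function theorem *)

Section Inverse.
Variable R : realType.
Local Open Scope complex_scope.
Local Notation Re := complex.Re.
Local Notation Im := complex.Im.

Lemma ReMB (a u w d : R[i]) (h : R) :
  Re (a * u) - Re (a * w) - Re (a * d) * h = Re (a * (u - w - h%:C * d)).
Proof. by case: a u w d => [? ?] [? ?] [? ?] [? ?] /=; ring. Qed.

(** Real mean value theorem along the segment from [z'] to [z], for the real part of each coordinate
    rotated by a unit scalar [a]. *)
Lemma lipschitz_ball m n (f : 'rV[R[i]]_m -> 'rV[R[i]]_n) (K s : R) : 0 <= K ->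
  (forall z, rnorm z <= s -> differentiable f z) ->
  (forall z v, rnorm z <= s -> rnorm ('d f z v) <= K * rnorm v) ->
  forall z z', rnorm z <= s -> rnorm z' <= s ->
    rnorm (f z - f z') <= K * rnorm (z - z').
Proof.
move=> K0 df dfK z z' zs z's; have Kz : 0 <= K * rnorm (z - z') by rewrite mulr_ge0// rnorm_ge0.
apply: rnorm_coord_le => // j; apply: rnorm_le_Re => // a a1.
pose v := z - z'; pose p (t : R) := z' + t%:C *: v.
pose g (t : R) : R := Re (a * f (p t) ord0 j).
pose g' (t : R) : R := Re (a * 'd f (p t) v ord0 j).
have ps t : t \in `[0, 1] -> rnorm (p t) <= s.
  rewrite in_itv/= => /andP[t0 t1].
  have -> : p t = (1 - t)%:C *: z' + t%:C *: z.
    by apply/rowP => k; rewrite /p /v !mxE rmorphB rmorph1; ring.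
  apply: le_trans (rnorm_triangle _ _) _; rewrite !rnormZ !rnorm_real !ger0_norm ?subr_ge0//.
  have -> : s = (1 - t) * s + t * s by ring.
  by apply: lerD; rewrite ler_wpM2l// subr_ge0.
have dg (t : R) : t \in `[0, 1] -> is_derive t 1 g (g' t).
  move=> t01; apply: is_derive_epsilon => e e0.
  have n1 : 0 < rnorm v + 1 by rewrite ltr_wpDl// rnorm_ge0.
  have e1 : 0 < e / (rnorm v + 1) by rewrite divr_gt0.
  have [d d0 dP] := differentiable_rnormP (df _ (ps t t01)) e1.
  exists (d / (rnorm v + 1)); first by rewrite divr_gt0.
  move=> h; rewrite ltr_pdivlMr// => hd.
  have hv : rnorm (h%:C *: v) <= `|h| * (rnorm v + 1).
    by rewrite rnormZ rnorm_real ler_wpM2l// lerDl.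
  have := dP _ (le_lt_trans hv hd).
  have -> : p t + h%:C *: v = p (t + h) by rewrite /p rmorphD /= scalerDl addrA.
  have -> : 'd f (p t) (h%:C *: v) = h%:C *: 'd f (p t) v by exact: linearZ.
  set D := _ - _ - _ => DP.
  have -> : g (t + h) - g t - g' t * h = Re (a * D ord0 j).
    by rewrite /g /g' ReMB /D !mxE.
  apply: le_trans (Re_le_rnorm _) _; rewrite rnormM a1 mul1r.
  apply: le_trans (rnorm_coord D j) _; apply: le_trans DP _.
  apply: le_trans (ler_wpM2l (ltW e1) hv) _.
  by rewrite mulrA mulrAC divfK ?gt_eqF// mulrC.
have [t t01] := mvt_derive ler01 dg.
have -> : g 1 - g 0 = Re (a * (f z - f z') ord0 j).
  have := ReMB a (f z ord0 j) (f z' ord0 j) 0 0; rewrite !mulr0 !subr0 => E.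
  by rewrite /g /p /v scale0r addr0 scale1r subrKC E !mxE.
rewrite subr0 mulr1 => ->.
apply: le_trans (ler_norm _) _; apply: le_trans (Re_le_rnorm _) _.
rewrite rnormM a1 mul1r; apply: le_trans (rnorm_coord ('d f (p t) v) j) _.
exact: dfK (ps t t01).
Qed.

Lemma injective_unitmx m (L : {linear 'rV[R[i]]_m -> 'rV[R[i]]_m}) :
  (forall v, L v = 0 -> v = 0) -> lin1_mx L \in unitmx.
Proof.
move=> Linj; rewrite -row_free_unit -kermx_eq0; apply/negPn/negP => /rowV0Pn[v].
by move=> /sub_kermxP; rewrite mul_rV_lin1 => /Linj ->; rewrite eqxx.
Qed.

Lemma linear_mulmx_continuous m n (B : 'M[R[i]]_(m, n)) :
  continuous (mulmxr B : 'rV_m -> 'rV_n).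
Proof.
move=> w; have [K K0 KP] := mulmx_bounded B.
have K1 : 0 < K + 1 by rewrite ltr_wpDl.
apply/continuous_rnormP => e e0; exists (e / (K + 1)); first by rewrite divr_gt0.
move=> y; rewrite ltr_pdivlMr// => yw; rewrite /= -mulmxBl.
apply: le_lt_trans (KP _) _; apply: le_lt_trans yw.
by rewrite mulrC ler_wpM2l ?rnorm_ge0// lerDl.
Qed.

(* Solve [z + G z = w] by minimising the residual: at a minimiser, moving by the
   residual halves it. *)
Lemma perturbed_identity_surjective m (G : 'rV[R[i]]_m -> 'rV[R[i]]_m) (s : R) w :
  0 < s -> G 0 = 0 -> (forall z, rnorm z <= s -> {for z, continuous G}) ->
  (forall z z', rnorm z <= s -> rnorm z' <= s ->
     rnorm (G z - G z') <= 2^-1 * rnorm (z - z')) ->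
  rnorm w < s / 8 -> exists2 z, rnorm z < s & z + G z = w.
Proof.
move=> s0 G0 cG lipG ws.
pose res z := w - (z + G z).
pose K := [set z : 'rV[R[i]]_m | rnorm z <= s].
have n0 : rnorm (0 : 'rV[R[i]]_m) <= s by rewrite rnorm0 ltW.
have Kne : K !=set0 by exists 0.
have cK : compact K by apply: compact_ball; exact: ltW.
have cf : {within K, continuous (fun z => rnorm (res z))}.
  apply: continuous_in_subspaceT => z; rewrite inE => zs.
  apply: (@continuous_comp _ _ _ res (@rnorm R _)); last exact: continuous_rnorm.
  apply: continuousB; first exact: cst_continuous.
  by apply: continuousD; [exact: cvg_id|exact: cG].
have [z zK zmin] := compact_EVT_min Kne cK cf.
rewrite inE/K/= in zK.
have r0 : rnorm (res z) <= rnorm w.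
  by have := zmin 0 (mem_set n0); rewrite {2}/res G0 addr0 subr0.
have Gz : rnorm (G z) <= 2^-1 * rnorm z.
  by have := lipG z 0 zK n0; rewrite G0 !subr0.
have zE : z = w - res z - G z by rewrite /res; apply/rowP => j; rewrite !mxE; ring.
(* Hence [z1] has norm at most [5 * rnorm w], below [s], and competes with the minimiser. *)
have z4 : rnorm z <= 4 * rnorm w.
  have := rnorm_triangleB (w - res z) (G z); rewrite -zE.
  have := rnorm_triangleB w (res z); lra.
pose z1 := z + res z.
have z1s : rnorm z1 <= s by have := rnorm_triangle z (res z); rewrite -/z1; lra.
have res1 : res z1 = G z - G z1.
  by rewrite {1}/res /z1 {1}/res; apply/rowP => j; rewrite !mxE; ring.
have := zmin z1 (mem_set z1s); rewrite res1 => min1.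
have := lipG _ _ zK z1s; rewrite /z1 opprD addNKr rnormN => half.
have rz : res z = 0.
  apply/eqP; rewrite -rnorm_eq0 eq_le rnorm_ge0 andbT.
  by move: min1 half; clear; lra.
exists z; first by lra.
by apply/eqP; rewrite eq_sym -subr_eq0 -/(res z) rz.
Qed.
End Inverse.

Section InverseFunction.
Variables (R : realType) (m : nat).
Implicit Types (z w v : 'rV[R[i]]_m).
Local Open Scope complex_scope.

(** The derivative of [g] is the inverse of [D]: with [h = g (w + k) - g w], the identity for
    [H (g _)] gives k - D h = o(h), which is o(k) by the Lipschitz bound, and the inverse of [D] is
    bounded. *)
Lemma differentiable_inverse (H g : 'rV[R[i]]_m -> 'rV[R[i]]_m) (V : set 'rV[R[i]]_m) w (K : R) :
  nbhs w V -> V w -> 0 <= K -> (forall y, V y -> H (g y) = y) ->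
  (forall y, V y -> rnorm (g y - g w) <= K * rnorm (y - w)) ->
  differentiable H (g w) -> (forall v, 'd H (g w) v = 0 -> v = 0) ->
  differentiable g w.
Proof.
move=> /nbhs_rnormP[r r0 rV] Vw K0 Hg gK dH dHinj.
have Du := injective_unitmx dHinj; set D := lin1_mx _ in Du.
have [K' K'0 K'P] := mulmx_bounded (invmx D).
apply: (fun cL fL => (rnormP_diff (L := mulmxr (invmx D)) cL fL).1).
  exact: linear_mulmx_continuous.
move=> e e0.
have c0 : 0 < K' * K + 1 by rewrite ltr_wpDl// mulr_ge0.
have K1 : 0 < K + 1 by rewrite ltr_wpDl.
have e1 : 0 < e / (K' * K + 1) by rewrite divr_gt0.
have [d d0 dP] := differentiable_rnormP dH e1.
exists (Num.min r (d / (K + 1))); first by rewrite lt_min r0 divr_gt0.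
move=> k; rewrite lt_min => /andP[kr]; rewrite ltr_pdivlMr// => kd.
have Vk : V (w + k) by apply: rV; rewrite addrC addKr.
pose h := g (w + k) - g w.
have hk : rnorm h <= K * rnorm k by have := gK _ Vk; rewrite [w + k - w]addrC addKr.
have hd : rnorm h < d.
  by apply: le_lt_trans hk _; apply: le_lt_trans kd; rewrite mulrC ler_wpM2l ?rnorm_ge0// lerDl.
have := dP _ hd; rewrite subrKC !Hg// [w + k - w]addrC addKr => kD.
have -> : g (w + k) - g w - mulmxr (invmx D) k = - ((k - 'd H (g w) h) *m invmx D).
  have -> : 'd H (g w) h = h *m D by rewrite mul_rV_lin1.
  by rewrite mulmxBl mulmxK// opprB.
rewrite rnormN; apply: le_trans (K'P _) _; apply: le_trans (ler_wpM2l K'0 kD) _.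
apply: (@le_trans _ _ (K' * (e / (K' * K + 1) * (K * rnorm k)))).
  by rewrite ler_wpM2l// ler_wpM2l// ltW.
have -> : K' * (e / (K' * K + 1) * (K * rnorm k)) =
    (K' * K / (K' * K + 1)) * (e * rnorm k) by field; rewrite gt_eqF.
rewrite ler_piMl ?mulr_ge0 ?rnorm_ge0// ?(ltW e0)//.
by rewrite ler_pdivrMr// mul1r lerDl.
Qed.

(** Normalise to [H z *m B = z + G z] with [G] of zero derivative at 0. Then [G] is small on a ball,
    Cauchy's estimate bounds its derivative by 1/2 on the half ball, and [G] is a 1/2-Lipschitz
    perturbation of the identity. *)
Lemma inverse_function_theorem (Z W : set 'rV[R[i]]_m)
    (H : 'rV[R[i]]_m -> 'rV[R[i]]_m) :
  open_nbhs (0 : 'rV[R[i]]_m) Z -> open_nbhs (0 : 'rV[R[i]]_m) W ->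
  holomorphic_on Z H -> H 0 = 0 ->
  (forall v, 'd H 0 v = 0 -> v = 0) -> invertible_near Z W H 0.
Proof.
move=> [oZ Z0] [oW W0] dH H0 dHinj.
have Au := injective_unitmx dHinj; set A := lin1_mx _ in Au.
pose B : 'M[R[i]]_m := invmx A; pose G z : 'rV[R[i]]_m := H z *m B - z.
have [K K0 KP] := mulmx_bounded B.
have /nbhs_rnormP[r1 r10 r1Z] : nbhs (0 : 'rV[R[i]]_m) Z by apply: open_nbhs_nbhs.
have dGP z : Z z -> differentiable G z /\ forall v, 'd G z v = 'd H z v *m B - v.
  move=> Zz; pose M : 'M[R[i]]_m := lin1_mx ('d H z) *m B - 1%:M.
  have ME v : mulmxr M v = 'd H z v *m B - v.
    by rewrite /= /M mulmxBr mulmx1 mulmxA mul_rV_lin1.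
  have [|dG dGE] := @rnormP_diff R _ _ G z (mulmxr M) (@linear_mulmx_continuous R m m M).
    move=> e e0; have K1 : 0 < K + 1 by rewrite ltr_wpDl.
    have e1 : 0 < e / (K + 1) by rewrite divr_gt0.
    have [d d0 dP] := differentiable_rnormP (dH z Zz) e1.
    exists d => // h /dP hd.
    rewrite [X in rnorm (_ - X)](_ : _ = 'd H z h *m B - h); last exact: ME.
    have -> : G (z + h) - G z - ('d H z h *m B - h) = (H (z + h) - H z - 'd H z h) *m B.
      by rewrite !mulmxBl /G; apply/rowP => j; rewrite !mxE; ring.
    apply: le_trans (KP _) _; apply: le_trans (ler_wpM2l K0 hd) _.
    rewrite mulrA ler_wpM2r ?rnorm_ge0// mulrCA ler_piMr ?(ltW e0)//.
    by rewrite ler_pdivrMr// mul1r lerDl.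
  split; first exact: dG.
  by move=> v; exact: (etrans (congr1 (fun f => f v) dGE) (ME v)).
have dG z (Zz : Z z) := (dGP z Zz).1.
have dGE z v (Zz : Z z) := (dGP z Zz).2 v.
have G0 : G 0 = 0 by rewrite /G H0 mul0mx subr0.
have dG0 v : 'd G 0 v = 0.
  by rewrite dGE// -[X in X *m B](mul_rV_lin1 ('d H 0)) mulmxK// subrr.
(* Cauchy's estimate turns [r / 16] into 8 (r/16) / r = 1/2. *)
have e0 : (0 : R) < 16^-1 by rewrite invr_gt0.
have [r2 r20 r2P] := differentiable_rnormP (dG 0 Z0) e0.
pose r := Num.min r1 r2.
have r0 : 0 < r by rewrite lt_min r10.
have rZ z : rnorm z < r -> Z z.
  by rewrite lt_min => /andP[zr _]; apply: r1Z; rewrite subr0.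
have GM z : rnorm z < r -> rnorm (G z) <= r / 16.
  move=> zr; have := r2P z; rewrite add0r G0 dG0 !subr0 => H2.
  apply: le_trans (H2 _) _; first by apply: lt_le_trans zr _; rewrite ge_min lexx orbT.
  by rewrite mulrC ler_pM2r// ltW.
have M0 : 0 <= r / 16 by rewrite divr_ge0// ltW.
have DG := Cauchy_estimate r0 M0 (fun z zr => dG z (rZ z zr)) GM.
have DG2 z v : rnorm z <= r / 2 -> rnorm ('d G z v) <= 2^-1 * rnorm v.
  move=> zr; apply: le_trans (DG z v zr) _.
  by rewrite le_eqVlt; apply/orP; left; apply/eqP; field; rewrite gt_eqF.
set s := r / 2 in DG2.
have s0 : 0 < s by rewrite divr_gt0.
have sr z : rnorm z <= s -> rnorm z < r by move=> zs; rewrite /s in zs; lra.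
have lipG := lipschitz_ball (K := 2^-1) (s := s) _ (fun z zs => dG z (rZ z (sr z zs))) DG2.
have {}lipG z z' : rnorm z <= s -> rnorm z' <= s ->
    rnorm (G z - G z') <= 2^-1 * rnorm (z - z').
  by apply: lipG; rewrite invr_ge0.
have HB z : H z *m B = z + G z by rewrite /G subrKC.
(* This gives both the injectivity of [H] on the ball and the Lipschitz bound for its inverse. *)
have lipH z z' : rnorm z <= s -> rnorm z' <= s ->
    rnorm (z - z') <= 2 * rnorm ((H z - H z') *m B).
  move=> zs z's; have := lipG _ _ zs z's.
  have := rnorm_triangleB ((H z - H z') *m B) (G z - G z').
  have -> : (H z - H z') *m B - (G z - G z') = z - z'.
    by rewrite mulmxBl !HB; apply/rowP => j; rewrite !mxE; ring.
  lra.
pose V := W `&` [set w | rnorm (w *m B) < s / 8].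
have oV : open V.
  apply: openI => //.
  have -> : [set w | rnorm (w *m B) < s / 8] =
      (@rnorm R _ \o mulmxr B) @^-1` [set x | x < s / 8] by [].
  apply: open_comp; last exact: open_lt.
  move=> w _; apply: continuous_comp; [exact: linear_mulmx_continuous|exact: continuous_rnorm].
have s8 : 0 < s / 8 by rewrite divr_gt0.
have V0 : V 0 by split=> //=; rewrite mul0mx rnorm0.
pose U := [set z | rnorm z < s /\ V (H z)].
have US z : U z -> rnorm z <= s by move=> [zs _]; exact: ltW.
have oU : open U.
  rewrite openE => z [zs Vz].
  have cH : {for z, continuous H}.
    by apply/differentiable_continuous/dH/rZ/sr/ltW.
  apply: filterI; last by apply: cH; apply: open_nbhs_nbhs.
  apply/nbhs_rnormP; exists (s - rnorm z); first by rewrite subr_gt0.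
  by move=> y yz /=; have := rnorm_triangle (y - z) z; rewrite subrK; lra.
have ex w : exists z, V w -> rnorm z < s /\ H z = w.
  have [Vw|] := pselect (V w); last by exists 0.
  have cG z : rnorm z <= s -> {for z, continuous G}.
    by move=> zs; apply/differentiable_continuous/dG/rZ/sr.
  have [z zs zw] := perturbed_identity_surjective s0 G0 cG lipG Vw.2.
  exists z => _; split => //.
  have := HB z; rewrite zw => /(congr1 (mulmx^~ A)).
  by rewrite !mulmxKV.
have [g gP] := choice ex.
have gU w : V w -> U (g w) by move=> Vw; have [? Hg] := gP w Vw; split => //; rewrite Hg.
exists U, V; split.
- by split => //; split; rewrite /= ?rnorm0 ?H0.
- by move=> z Uz; apply/rZ/sr/US.
- by rewrite H0.
- by move=> w [].
exists g; split.
- by move=> z Uz; apply/dH/rZ/sr/US.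
- move=> w Vw; have [gws Hgw] := gP w Vw.
  have K20 : 0 <= 2 * K by rewrite mulr_ge0.
  have nV : nbhs w V by apply: open_nbhs_nbhs.
  have Hg y : V y -> H (g y) = y by move=> /gP[].
  have glip y : V y -> rnorm (g y - g w) <= 2 * K * rnorm (y - w).
    move=> Vy; have [gys Hgy] := gP y Vy.
    apply: le_trans (lipH _ _ (ltW gys) (ltW gws)) _; rewrite Hgw Hgy -mulrA.
    by rewrite ler_wpM2l.
  have Zg : Z (g w) by exact/rZ/sr/ltW.
  (* A kernel vector of the derivative of [H] satisfies DG v = -v, impossible for [v != 0] when DG
     has norm at most 1/2. *)
  have inj v : 'd H (g w) v = 0 -> v = 0.
    move=> Hv; have := DG2 (g w) v (ltW gws); rewrite (dGE _ _ Zg).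
    rewrite Hv mul0mx sub0r rnormN => v2; apply/eqP; rewrite -rnorm_eq0.
    by rewrite eq_le rnorm_ge0 andbT; move: v2; clear; lra.
  exact: (differentiable_inverse nV Vw K20 Hg glip (dH _ Zg) inj).
- split=> [_ [z [zs Vz] <-]//|_ [w Vw <-]]; exact: gU.
- move=> z [zs Vz]; have [gs Hg] := gP _ Vz.
  apply/eqP; rewrite -subr_eq0 -rnorm_eq0 eq_le rnorm_ge0 andbT.
  have := lipH _ _ (ltW gs) (ltW zs).
  by rewrite Hg subrr mul0mx rnorm0 mulr0.
- by move=> w /gP[].
Qed.
End InverseFunction.

(** * From the reality conditions on [H] to its local inverse *)

Theorem proposition6p4 (R : realType) (m : nat) (Z W : set 'rV[R[i]]_m)
    (H : 'rV[R[i]]_m -> 'rV[R[i]]_m)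
    (Z_nbhs : open_nbhs (0 : 'rV[R[i]]_m) Z)
    (W_nbhs : open_nbhs (0 : 'rV[R[i]]_m) W)
    (H_maps : H @` Z `<=` W)
    (H_hol : holomorphic_on Z H)
    (H0 : H 0 = 0)
    (H_real : H @` (Z `&` @real_subspace R m) `<=` @real_subspace R m)
    (H_preal : Z `&` H @^-1` (W `&` @real_subspace R m) `<=` @real_subspace R m) :
  invertible_near Z W H 0.
Proof.
apply: inverse_function_theorem => //.
have /nbhs_rnormP[r r0 rZ] : nbhs (0 : 'rV[R[i]]_m) Z by apply: open_nbhs_nbhs.
(* The compactness argument needs a closed ball inside [Z]. *)
have r20 : 0 < r / 2 by rewrite divr_gt0.
have inZ (z : 'rV[R[i]]_m) : rnorm z <= r / 2 -> Z z by move=> zr; apply: rZ; rewrite subr0; lra.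
have realP (z : 'rV[R[i]]_m) : Im_norm z = 0 <-> real_subspace z.
  split=> [/Im_norm_eq0 z0|[x _ <-]].
    exists (map_mx (@complex.Re R) z) => //; apply/rowP => j; rewrite !mxE.
    by have := z0 j; case: (z ord0 j) => x y /= ->.
  by apply/Im_norm_eq0 => j; rewrite mxE.
apply: (derivative_injective r20) => // z zr.
  exact/H_hol/inZ.
move=> /realP Hz; apply/realP/H_preal; split; first exact: inZ.
by split => //; apply: H_maps; exists z => //; exact: inZ.
Qed.
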